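(* Let $n\ge 0$. The assignment $\partial_i^J\mapsto \partial_{\mathtt a_i^J}$ (and the identification of compositions of $n$ with subsets $J\subset S$ on objects) defines an isomorphism of $\mathbb Z$-linear categories (algebroids) $$\psi\colon \mathrm{LNC}(n)\xrightarrow{\ \sim\ }\mathcal{AD}(\mathcal S_n)$$ from the labeled nilCoxeter algebroid to the atomic subcategory $\mathcal{AD}(\mathcal S_n)$ of the nilCoxeter algebroid of double cosets $\mathcal D(\mathcal S_n)$.
   Context: $W=\mathcal S_n$, $S=\{s_1,\dots,s_{n-1}\}$, length $\ell$. For $I\subset S$, $W_I$ is the parabolic subgroup, $w_I$ its longest element, $\ell(I)=\ell(w_I)$. An $(I,J)$-coset is an element $p\in W_I\backslash W/W_J$ (with $(I,J)$ part of the data), with Bruhat-maximal element $\overline p$. Let $*$ be the $0$-Hecke (star) product on $W$ ($s*w=sw$ if $\ell(sw)>\ell(w)$, else $s*w=w$). For an $(I,J)$-coset $p$ and a $(J,K)$-coset $q$, $p*q=W_I(\overline p*\overline q)W_K$; it is reduced if $\overline p*\overline q=(\overline pw_J^{-1})\overline q$ with $\ell(\overline p*\overline q)=\ell(\overline p)-\ell(J)+\ell(\overline q)$. $\mathcal D=\mathcal D(W,S)$ is the $\mathbb Z$-linear category whose objects are the subsets of $S$, with $\mathrm{Hom}(J,I)$ the free $\mathbb Z$-module with basis $\{\partial_p\}$ over $(I,J)$-cosets $p$, and composition $\partial_p\circ\partial_q=\partial_{p*q}$ if $p*q$ is reduced, $\partial_p\circ\partial_q=0$ otherwise. Atomic cosets: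 for $J\subset S$ write $S\setminus J=\{s_{d_1},\dots,s_{d_l}\}$, $d_1<\dots<d_l$. For $s=s_{d_i}$, $M=J\cup\{s\}$, $t=w_Msw_M$, let $\mathtt a_i^J$ be the $(M\setminus\{t\},J)$-coset containing $w_M$. These are the atomic cosets. $\mathcal{AD}(\mathcal S_n)$ is the (non-full) $\mathbb Z$-linear subcategory of $\mathcal D$ with all objects, generated by $\partial_p$ for $p$ atomic. $\mathrm{LNC}(n)$ is the $\mathbb Z$-linear category presented as follows. Objects are compositions $(n_1,\dots,n_k)$ of $n$ (positive parts, $\sum n_c=n$), identified with the subset $J\subset S$ such that $W_J=\mathcal S_{n_1}\times\cdots\times\mathcal S_{n_k}$. Generating morphisms are $\partial_i^J$ for $1\le i\le k-1$, from $J\leftrightarrow(n_1,\dots,n_i,n_{i+1},\dots,n_k)$ to $(n_1,\dots,n_{i+1},n_i,\dots,n_k)$. The relations, for every $J$ (omitted superscripts being the unique ones making compositions well defined), are $\partial_i\partial_{i+1}\partial_i^J=\partial_{i+1}\partial_i\partial_{i+1}^J$ for $1\le i\le k-2$; $\partial_i\partial_j^J=\partial_j\partial_i^J$ for $|i-j|>1$; and $\partial_i\partial_i^J=0$ for $1\le i\le k-1$. *)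

(* Defs.v *)
From HB Require Import structures.
From mathcomp Require Import all_boot all_order all_algebra all_fingroup.
From mathcomp Require Import generic_quotient boolp.

Set Implicit Arguments.
Unset Strict Implicit.
Unset Printing Implicit Defensive.

Import GRing.Theory.
Local Open Scope ring_scope.
Local Open Scope quotient_scope.

(* [mcomp g f] is "g after f". *)
Record algebroid_data : Type := AlgebroidData {
  obj :> Type;
  mor : obj -> obj -> zmodType;
  idm : forall a, mor a a;
  mcomp : forall a b c, mor b c -> mor a b -> mor a c }.

Arguments idm {a0} a : rename.
Arguments mcomp {a0 a b c} : rename.
Arguments mor {a0} : rename.

Record is_algebroid (C : algebroid_data) : Prop := IsAlgebroid {
  compA : forall (a b c d : C) (h : mor c d) (g : mor b c) (f : mor a b),
    mcomp h (mcomp g f) = mcomp (mcomp h g) f;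
  compid1 : forall (a b : C) (f : mor a b), mcomp (idm b) f = f;
  compid2 : forall (a b : C) (f : mor a b), mcomp f (idm a) = f;
  compDl : forall (a b c : C) (g1 g2 : mor b c) (f : mor a b),
    mcomp (g1 + g2) f = mcomp g1 f + mcomp g2 f;
  compDr : forall (a b c : C) (g : mor b c) (f1 f2 : mor a b),
    mcomp g (f1 + f2) = mcomp g f1 + mcomp g f2 }.

Record functor (C D : algebroid_data) : Type := Functor {
  fobj :> C -> D;
  fmap : forall a b : C, {additive mor a b -> mor (fobj a) (fobj b)};
  fmap_id : forall a : C, fmap a a (idm a) = idm (fobj a);
  fmap_comp : forall (a b c : C) (g : mor b c) (f : mor a b),
    fmap a c (mcomp g f) = mcomp (fmap b c g) (fmap a b f) }.

Arguments fmap {C D} f {a b} : rename.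

(* A morphism packed with its source and target, so that equality of          *)
(* morphisms includes equality of the end points.                             *)
Definition arrow (C : algebroid_data) (a b : C) (f : mor a b) :
    {x : C & {y : C & mor x y}} :=
  existT _ a (existT _ b f).

Definition is_isomorphism (C D : algebroid_data) (F : functor C D) : Prop :=
  exists G : functor D C,
    (forall (a b : C) (f : mor a b), arrow (fmap G (fmap F f)) = arrow f) /\
    (forall (x y : D) (g : mor x y), arrow (fmap F (fmap G g)) = arrow g).

(* The (non-full, wide) Z-linear subcategory generated by a family of         *)
(* morphisms.                                                                 *)

Section Generated.
Variables (C : algebroid_data) (G : forall a b : C, mor a b -> Prop).

Inductive generated : forall a b : C, mor a b -> Prop :=
| generated_base a b (f : mor a b) : G f -> generated f
| generated_id a : generated (idm a)
| generated_comp a b c (g : mor b c) (f : mor a b) :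
    generated g -> generated f -> generated (mcomp g f)
| generated0 a b : generated (0 : mor a b)
| generatedB a b (f g : mor a b) :
    generated f -> generated g -> generated (f - g).

Definition generated_pred (a b : C) : pred (mor a b) :=
  fun f => `[< generated f >].

Lemma generated_zmod_closed a b : zmod_closed (@generated_pred a b).
Proof.
split; first by apply/asboolP; exact: generated0.
by move=> f g /asboolP hf /asboolP hg; apply/asboolP; exact: generatedB.
Qed.

HB.instance Definition _ a b :=
  GRing.isZmodClosed.Build (mor a b) (@generated_pred a b)
    (@generated_zmod_closed a b).

Record generated_hom (a b : C) : Type := GeneratedHom {
  gen_val : mor a b;
  gen_valP : gen_val \in @generated_pred a b }.

HB.instance Definition _ a b := [isSub for @gen_val a b].
HB.instance Definition _ a b := [Choice of generated_hom a b by <:].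
HB.instance Definition _ a b :=
  [SubChoice_isSubZmodule of generated_hom a b by <:].

Lemma generated_idP a : idm a \in @generated_pred a a.
Proof. by apply/asboolP; exact: generated_id. Qed.

Lemma generated_compP a b c (g : generated_hom b c) (f : generated_hom a b) :
  mcomp (gen_val g) (gen_val f) \in @generated_pred a c.
Proof.
by apply/asboolP; apply: generated_comp; apply/asboolP; exact: gen_valP.
Qed.

Definition generated_subalgebroid : algebroid_data :=
  {| obj := C;
     mor := fun a b => generated_hom a b : zmodType;
     idm := fun a => GeneratedHom (generated_idP a);
     mcomp := fun a b c g f => GeneratedHom (generated_compP g f) |}.

End Generated.

(* The Z-linear category presented by generating morphisms and relations:     *)
(* formal expressions modulo the least congruence which contains the          *)
(* relations and the laws of a Z-linear category.                             *)

Section Presented.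
Variables (O : Type) (gen : O -> O -> Type).

Inductive term : O -> O -> Type :=
| t_gen a b of gen a b : term a b
| t_id a : term a a
| t_comp a b c of term b c & term a b : term a c
| t_zero a b : term a b
| t_opp a b of term a b : term a b
| t_add a b of term a b & term a b : term a b.

Variable rel : forall a b, term a b -> term a b -> Prop.

Inductive cong : forall a b, term a b -> term a b -> Prop :=
| cong_rel a b (f g : term a b) : rel f g -> cong f g
| cong_refl a b (f : term a b) : cong f f
| cong_sym a b (f g : term a b) : cong f g -> cong g f
| cong_trans a b (f g h : term a b) : cong f g -> cong g h -> cong f h
| cong_comp a b c (g g' : term b c) (f f' : term a b) :
    cong g g' -> cong f f' -> cong (t_comp g f) (t_comp g' f')
| cong_opp a b (f f' : term a b) : cong f f' -> cong (t_opp f) (t_opp f')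
| cong_add a b (f f' g g' : term a b) :
    cong f f' -> cong g g' -> cong (t_add f g) (t_add f' g')
| cong_addA a b (f g h : term a b) :
    cong (t_add f (t_add g h)) (t_add (t_add f g) h)
| cong_addC a b (f g : term a b) : cong (t_add f g) (t_add g f)
| cong_add0 a b (f : term a b) : cong (t_add (t_zero a b) f) f
| cong_addN a b (f : term a b) : cong (t_add (t_opp f) f) (t_zero a b)
| cong_compA a b c d (h : term c d) (g : term b c) (f : term a b) :
    cong (t_comp h (t_comp g f)) (t_comp (t_comp h g) f)
| cong_id1 a b (f : term a b) : cong (t_comp (t_id b) f) f
| cong_id2 a b (f : term a b) : cong (t_comp f (t_id a)) f
| cong_compDl a b c (g g' : term b c) (f : term a b) :
    cong (t_comp (t_add g g') f) (t_add (t_comp g f) (t_comp g' f))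
| cong_compDr a b c (g : term b c) (f f' : term a b) :
    cong (t_comp g (t_add f f')) (t_add (t_comp g f) (t_comp g f')).

HB.instance Definition _ a b := gen_eqMixin (term a b).
HB.instance Definition _ a b := gen_choiceMixin (term a b).

Definition congb a b (f g : term a b) : bool := `[< cong f g >].

Lemma congb_equiv a b : equiv_class_of (@congb a b).
Proof.
split=> [f|f g|g f h].
- by apply/asboolP; exact: cong_refl.
- by apply/asboolP/asboolP; exact: cong_sym.
- by move=> /asboolP fg /asboolP gh; apply/asboolP; exact: cong_trans gh.
Qed.

Canonical congb_equivRel a b := EquivRelPack (@congb_equiv a b).

Definition presented_hom a b : Type := {eq_quot (@congb_equivRel a b)}.

HB.instance Definition _ a b := Choice.on (presented_hom a b).

Definition cls a b (f : term a b) : presented_hom a b :=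
  \pi_{eq_quot (@congb_equivRel a b)} f.
Definition rep a b (f : presented_hom a b) : term a b := repr f.

Lemma clsP a b (f g : term a b) : cls f = cls g <-> cong f g.
Proof. by split=> [/eqmodP/asboolP|fg]; last exact/eqmodP/asboolP. Qed.

Lemma repK a b (f : presented_hom a b) : cls (rep f) = f.
Proof. exact: reprK. Qed.

Lemma cong_rep a b (f : term a b) : cong (rep (cls f)) f.
Proof. by apply/clsP; rewrite repK. Qed.

Definition p_zero a b : presented_hom a b := cls (t_zero a b).
Definition p_opp a b (f : presented_hom a b) := cls (t_opp (rep f)).
Definition p_add a b (f g : presented_hom a b) := cls (t_add (rep f) (rep g)).
Definition p_id a : presented_hom a a := cls (t_id a).
Definition p_comp a b c (g : presented_hom b c) (f : presented_hom a b) :=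
  cls (t_comp (rep g) (rep f)).

Lemma p_oppE a b (f : term a b) : p_opp (cls f) = cls (t_opp f).
Proof. by apply/clsP/cong_opp/cong_rep. Qed.

Lemma p_addE a b (f g : term a b) : p_add (cls f) (cls g) = cls (t_add f g).
Proof. by apply/clsP; apply: cong_add; exact: cong_rep. Qed.

Lemma p_compE a b c (g : term b c) (f : term a b) :
  p_comp (cls g) (cls f) = cls (t_comp g f).
Proof. by apply/clsP; apply: cong_comp; exact: cong_rep. Qed.

Lemma p_addA a b : associative (@p_add a b).
Proof.
move=> f g h; rewrite -(repK f) -(repK g) -(repK h) !p_addE.
exact/clsP/cong_addA.
Qed.

Lemma p_addC a b : commutative (@p_add a b).
Proof. by move=> f g; rewrite -(repK f) -(repK g) !p_addE; exact/clsP/cong_addC. Qed.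

Lemma p_add0 a b : left_id (p_zero a b) (@p_add a b).
Proof. by move=> f; rewrite -(repK f) p_addE; exact/clsP/cong_add0. Qed.

Lemma p_addN a b : left_inverse (p_zero a b) (@p_opp a b) (@p_add a b).
Proof. by move=> f; rewrite -(repK f) p_oppE p_addE; exact/clsP/cong_addN. Qed.

HB.instance Definition _ a b :=
  GRing.isZmodule.Build (presented_hom a b)
    (@p_addA a b) (@p_addC a b) (@p_add0 a b) (@p_addN a b).

Definition presented_algebroid : algebroid_data :=
  {| obj := O;
     mor := fun a b => presented_hom a b : zmodType;
     idm := p_id;
     mcomp := p_comp |}.

Lemma presented_is_algebroid : is_algebroid presented_algebroid.
Proof.
split=> /=.
- move=> a b c d h g f; rewrite -(repK f) -(repK g) -(repK h) !p_compE.
  exact/clsP/cong_compA.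
- by move=> a b f; rewrite -(repK f) p_compE; exact/clsP/cong_id1.
- by move=> a b f; rewrite -(repK f) p_compE; exact/clsP/cong_id2.
- move=> a b c g1 g2 f; rewrite -(repK f) -(repK g1) -(repK g2).
  rewrite [cls _ + cls _]p_addE !p_compE [RHS]p_addE.
  exact/clsP/cong_compDl.
- move=> a b c g f1 f2; rewrite -(repK g) -(repK f1) -(repK f2).
  rewrite [cls _ + cls _]p_addE !p_compE [RHS]p_addE.
  exact/clsP/cong_compDr.
Qed.

End Presented.

(* The Coxeter system (S_n, S).  A subset of S is a set of indices            *)
(* d : 'I_n.-1, where d stands for the transposition of the points d and d+1  *)
(* of 'I_n (indices are shifted by one: s_{d+1} in the usual numbering).      *)
(* Products in 'S_n compose from left to right; as w |-> w^-1 fixes S, the    *)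
(* opposite convention gives an isomorphic Coxeter system.                    *)

Lemma ltn_simple n (d : 'I_n.-1) : (d.+1 < n)%N.
Proof. by case: n d => [[]//|n] [d]. Qed.

Definition lo n (d : 'I_n.-1) : 'I_n := Ordinal (ltnW (ltn_simple d)).
Definition hi n (d : 'I_n.-1) : 'I_n := Ordinal (ltn_simple d).

Definition simple n (d : 'I_n.-1) : 'S_n := tperm (lo d) (hi d).

Definition word_prod n (u : seq 'I_n.-1) : 'S_n := (\prod_(d <- u) simple d)%g.

Section SimpleGeneration.
Variable n : nat.
Implicit Types (w : 'S_n) (d : 'I_n.-1).

Let pot w := (\sum_(x : 'I_n) x * w x)%N.

Let pot_bound w : (pot w <= \sum_(x : 'I_n) n * n)%N.
Proof. by apply: leq_sum => x _; apply: leq_mul; apply/ltnW/ltn_ord. Qed.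

Let lo_neq_hi d : hi d != lo d.
Proof. by rewrite -val_eqE /= gtn_eqF. Qed.

Let pot_lt w d : (w (hi d) < w (lo d))%N -> (pot w < pot (simple d * w)%g)%N.
Proof.
have split2 (F : 'I_n -> nat) : (\sum_x F x =
    F (lo d) + (F (hi d) + \sum_(x | (x != lo d) && (x != hi d)) F x))%N.
  by rewrite (bigD1 (lo d)) //= (bigD1 (hi d)) ?lo_neq_hi.
move=> h; rewrite /pot !split2 !permM tpermL tpermR.
rewrite [X in (_ < _ + (_ + X))%N](eq_bigr (fun x : 'I_n => x * w x)%N); last first.
  by move=> x /andP[xl xh]; rewrite permM tpermD // eq_sym.
have -> : lo d = d :> nat by [].
have -> : hi d = d.+1 :> nat by [].
rewrite !mulSn; move: (w (lo d)) (w (hi d)) h (\sum_(x | _) _)%N => a b h r.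
move: (d * a)%N (d * b)%N => p q.
have -> : (p + (b + q + r) = b + (p + q + r))%N by rewrite !addnA (addnC p).
have -> : (q + (a + p + r) = a + (p + q + r))%N.
  by rewrite !addnA (addnC q) -!addnA (addnCA q).
by rewrite ltn_add2r.
Qed.

Let no_descent w : (forall d, ~~ (w (hi d) < w (lo d))%N) -> w = 1%g.
Proof.
move=> nd.
have mono k (x y : 'I_n) : y = (x + k)%N :> nat -> (w x + k <= w y)%N.
  elim: k x y => [|k IH] x y; first by rewrite !addn0 => /val_inj->.
  rewrite addnS => e.
  have xk : (x + k < n.-1)%N by rewrite -ltnS (ltn_predK (ltn_ord x)) -e ltn_ord.
  pose d := Ordinal xk.
  have hy : hi d = y by apply/val_inj; rewrite /= e.
  have := IH x (lo d) erefl; rewrite addnS => h; apply: leq_ltn_trans h _.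
  rewrite -hy ltn_neqAle leqNgt nd andbT.
  by apply/negP => /eqP /val_inj /perm_inj /eqP; rewrite eq_sym (negPf (lo_neq_hi d)).
apply/permP => x; rewrite perm1; apply/val_inj/eqP; rewrite eqn_leq.
have n0 : (0 < n)%N by apply: leq_ltn_trans (ltn_ord x).
have nl : (n.-1 < n)%N by rewrite prednK.
apply/andP; split.
  have := mono (n.-1 - x)%N x (Ordinal nl).
  rewrite /= subnKC; last by rewrite -ltnS prednK.
  move=> /(_ erefl) h.
  have {}h := leq_trans h (_ : (_ <= n.-1)%N).
  have := h _; rewrite -ltnS prednK // => /(_ (ltn_ord _)) {}h.
  have xn : (x <= n.-1)%N by rewrite -ltnS prednK.
  by rewrite -(leq_add2r (n.-1 - x)) subnKC // -ltnS prednK.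
have := mono x (Ordinal n0) x erefl.
by apply: leq_trans; rewrite leq_addl.
Qed.

Lemma monotone_word (b : 'I_n -> nat) w :
    (forall x y : 'I_n, (x <= y)%N -> (b x <= b y)%N) ->
    (forall x, b (w x) = b x) ->
  exists u : seq 'I_n.-1,
    all (fun d => b (lo d) == b (hi d)) u /\ w = word_prod u.
Proof.
move=> mb; move: {2}(_ - _)%N (leqnn (\sum_(x : 'I_n) n * n - pot w)) => m.
elim: m w => [|m IH] w hm bw;
  have [/existsP[d hd]|/existsPn nd] := boolP [exists d, (w (hi d) < w (lo d))%N].
- have := leq_trans (pot_lt hd) (pot_bound _).
  by rewrite ltnNge -subn_eq0 -leqn0 hm.
- by exists [::]; rewrite /word_prod big_nil; split=> //; exact: no_descent.
- have bd : b (lo d) = b (hi d).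
    apply/eqP; rewrite eqn_leq mb //=.
    by rewrite -(bw (hi d)) -(bw (lo d)) mb // ltnW.
  have [||u [hu eu]] := IH (simple d * w)%g.
  + rewrite -ltnS; apply: leq_trans hm.
    by apply: ltn_sub2l (pot_lt hd); apply: leq_trans (pot_lt hd) (pot_bound _).
  + move=> x; rewrite permM bw /simple.
    by case: tpermP => // ->.
  exists (d :: u); split; first by rewrite /= bd eqxx.
  by rewrite /word_prod big_cons -/(word_prod u) -eu mulgA tperm2 mul1g.
- by exists [::]; rewrite /word_prod big_nil; split=> //; exact: no_descent.
Qed.

Lemma ex_word_of_size w :
  exists k, [exists u : k.-tuple 'I_n.-1, word_prod u == w].
Proof.
have [//|//|u [_ ->]] := @monotone_word (fun=> 0%N) w.
by exists (size u); apply/existsP; exists (in_tuple u).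
Qed.

End SimpleGeneration.

Section Coxeter.
Variable n : nat.
Implicit Types (x y w : 'S_n) (I J K : {set 'I_n.-1}).

Definition len w : nat := ex_minn (ex_word_of_size w).

Lemma ex_reduced_word w :
  [exists u : (len w).-tuple 'I_n.-1, word_prod u == w].
Proof. by rewrite /len; case: ex_minnP. Qed.

Definition reduced_word w : seq 'I_n.-1 :=
  xchoose (existsP (ex_reduced_word w)).

Definition reflection : pred 'S_n :=
  fun t => [exists d : 'I_n.-1, exists x, t == (simple d ^ x)%g].

Definition bruhat_step : rel 'S_n :=
  fun x y => [exists t, [&& reflection t, y == (x * t)%g & (len x < len y)%N]].

Definition bruhat : rel 'S_n := connect bruhat_step.

Definition parabolic I : {group 'S_n} := <<[set simple d | d in I]>>%G.

Definition longest I : 'S_n := [arg max_(w > 1%g in parabolic I) len w].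

(* The 0-Hecke product: [star x y] is s_1 * (s_2 * ... (s_k * y)) for a       *)
(* reduced word s_1 ... s_k of x.                                             *)
Definition star_simple (d : 'I_n.-1) w : 'S_n :=
  if (len w < len (simple d * w)%g)%N then (simple d * w)%g else w.

Definition star x y : 'S_n := foldr star_simple y (reduced_word x).

Definition double_coset I w J : {set 'S_n} :=
  (parabolic I :* w * parabolic J)%g.

Record dcoset I J : Type := DCoset {
  dcoset_set :> {set 'S_n};
  _ : [exists w, dcoset_set == double_coset I w J] }.

HB.instance Definition _ I J := [isSub for @dcoset_set I J].
HB.instance Definition _ I J := [Finite of dcoset I J by <:].

Lemma dcoset_ofP I J w : [exists v, double_coset I w J == double_coset I v J].
Proof. by apply/existsP; exists w. Qed.

Definition dcoset_of I J w : dcoset I J := DCoset (dcoset_ofP I J w).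

(* The Bruhat-maximal element of p (every (I, J)-coset has one, so that the   *)
(* default value is irrelevant).                                              *)
Definition dmax I J (p : dcoset I J) : 'S_n :=
  odflt 1%g [pick w in dcoset_set p | [forall x in dcoset_set p, bruhat x w]].

Definition dstar I J K (p : dcoset I J) (q : dcoset J K) : dcoset I K :=
  dcoset_of I K (star (dmax p) (dmax q)).

(* The length condition is l(p*q) = l(p) - l(J) + l(q), without subtraction. *)
Definition dreduced I J K (p : dcoset I J) (q : dcoset J K) : bool :=
  (star (dmax p) (dmax q) == (dmax p * (longest J)^-1) * dmax q)%g &&
  (len (star (dmax p) (dmax q)) + len (longest J) ==
     len (dmax p) + len (dmax q))%N.

(* Morphisms from J to I: the free Z-module on the (I, J)-cosets. *)
Definition Dhom J I : zmodType := {ffun dcoset I J -> int}.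

Definition Dbasis I J (p : dcoset I J) : Dhom J I := [ffun q => (q == p)%:R].

Definition Dcomp_basis I J K (p : dcoset I J) (q : dcoset J K) : Dhom K I :=
  if dreduced p q then Dbasis (dstar p q) else 0.

Definition Dcomp K J I (f : Dhom J I) (g : Dhom K J) : Dhom K I :=
  \sum_(p : dcoset I J) \sum_(q : dcoset J K)
    Dcomp_basis p q *~ ((f : {ffun _ -> _}) p * (g : {ffun _ -> _}) q).

Definition nilCoxeter_algebroid : algebroid_data :=
  {| obj := {set 'I_n.-1};
     mor := Dhom;
     idm := fun I => Dbasis (dcoset_of I I 1%g);
     mcomp := Dcomp |}.

(* With s the i-th element of S \ J in increasing order (i counted from 0),   *)
(* M = J + s and t = w_M s w_M: the set M - t, and the atomic coset a_i^J.    *)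
Definition atomic_source J (i : 'I_#|~: J|) : {set 'I_n.-1} :=
  enum_val i |: J.

Definition atomic_target J (i : 'I_#|~: J|) : {set 'I_n.-1} :=
  let M := atomic_source i in
  [set d in M |
    simple d != (longest M * simple (enum_val i) * longest M)%g].

Definition atomic_coset J (i : 'I_#|~: J|) : dcoset (atomic_target i) J :=
  dcoset_of (atomic_target i) J (longest (atomic_source i)).

Inductive atomic_morphism :
    forall J I : nilCoxeter_algebroid, mor J I -> Prop :=
| AtomicMorphism J (i : 'I_#|~: J|) :
    @atomic_morphism J (atomic_target i) (Dbasis (atomic_coset i)).

Definition atomic_algebroid : algebroid_data :=
  generated_subalgebroid atomic_morphism.

End Coxeter.

Section LNC.
Variable n : nat.

Record composition : Type := Composition {
  parts :> seq nat;
  _ : all (leq 1) parts && (sumn parts == n) }.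

HB.instance Definition _ := [isSub for parts].
HB.instance Definition _ := [Choice of composition by <:].

Definition swap_parts (c : seq nat) (i : nat) : seq nat :=
  take i c ++ [:: nth 0%N c i.+1; nth 0%N c i] ++ drop i.+2 c.

Lemma swap_partsP (c : composition) (i : 'I_(size c).-1) :
  all (leq 1) (swap_parts c i) && (sumn (swap_parts c i) == n).
Proof.
have hi := ltn_simple i.
case: c i hi => c /= cP i hi.
have ec : c = take i c ++ [:: nth 0%N c i; nth 0%N c i.+1] ++ drop i.+2 c.
  by rewrite -[LHS](cat_take_drop i) (drop_nth 0%N (ltnW hi)) (drop_nth 0%N hi).
have pc : perm_eq (swap_parts c i) c.
  rewrite [X in perm_eq _ X]ec /swap_parts perm_cat2l perm_cat2r.
  by rewrite (perm_catC [:: _] [:: _]).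
by rewrite (perm_all _ pc) (perm_sumn pc).
Qed.

Definition swap (c : composition) (i : 'I_(size c).-1) : composition :=
  Composition (swap_partsP i).

(* The generating morphisms from a to b: the i (counted from 0) such that     *)
(* exchanging the parts i and i+1 of a yields b.                              *)
Definition lnc_gen (a b : composition) : Type :=
  {i : 'I_(size a).-1 | b == swap i}.

Definition lnc_idx a b (g : lnc_gen a b) : nat := val (val g).

Inductive lnc_rel :
    forall a b : composition, term lnc_gen a b -> term lnc_gen a b -> Prop :=
| lnc_braid a b1 b2 b1' b2' c
    (f1 : lnc_gen a b1) (f2 : lnc_gen b1 b2) (f3 : lnc_gen b2 c)
    (g1 : lnc_gen a b1') (g2 : lnc_gen b1' b2') (g3 : lnc_gen b2' c) (i : nat) :
    [/\ lnc_idx f1 = i, lnc_idx f2 = i.+1 & lnc_idx f3 = i] ->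
    [/\ lnc_idx g1 = i.+1, lnc_idx g2 = i & lnc_idx g3 = i.+1] ->
    lnc_rel (t_comp (t_gen f3) (t_comp (t_gen f2) (t_gen f1)))
            (t_comp (t_gen g3) (t_comp (t_gen g2) (t_gen g1)))
| lnc_far a b b' c
    (f1 : lnc_gen a b) (f2 : lnc_gen b c)
    (g1 : lnc_gen a b') (g2 : lnc_gen b' c) (i j : nat) :
    (i.+1 < j)%N || (j.+1 < i)%N ->
    lnc_idx f1 = j -> lnc_idx f2 = i -> lnc_idx g1 = i -> lnc_idx g2 = j ->
    lnc_rel (t_comp (t_gen f2) (t_gen f1)) (t_comp (t_gen g2) (t_gen g1))
| lnc_nil a b c (f1 : lnc_gen a b) (f2 : lnc_gen b c) :
    lnc_idx f1 = lnc_idx f2 ->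
    lnc_rel (t_comp (t_gen f2) (t_gen f1)) (t_zero _ a c).

Definition LNC : algebroid_data := presented_algebroid lnc_rel.

Definition lnc_morphism a b (g : lnc_gen a b) : @mor LNC a b :=
  cls lnc_rel (t_gen g).

(* The subset J of S identified with the composition c; [parabolic_subset_of] *)
(* below is the characterization W_J = S_{n_1} x ... x S_{n_k}.               *)
Definition partial_sums (c : seq nat) : seq nat := scanl addn 0%N c.

Definition subset_of (c : composition) : {set 'I_n.-1} :=
  [set d : 'I_n.-1 | d.+1 \notin partial_sums c].

(* The blocks of c are the maximal intervals of points x with the same        *)
(* [block c x], which is the number of parts lying entirely before x.         *)
Definition block (c : composition) (x : 'I_n) : nat :=
  count (fun m => m <= x)%N (partial_sums c).

Definition young (c : composition) : {set 'S_n} :=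
  [set w : 'S_n | [forall x, block c (w x) == block c x]].

Lemma parabolic_subset_of (c : composition) :
  parabolic (subset_of c) = young c :> {set 'S_n}.
Proof.
have mb (x y : 'I_n) : (x <= y)%N -> (block c x <= block c y)%N.
  by move=> xy; apply: sub_count => m /= mx; exact: leq_trans mx xy.
have bE d : (block c (lo d) == block c (hi d)) = (d \in subset_of c).
  rewrite inE /block /=; elim: (partial_sums c) => //= m t IH.
  rewrite in_cons negb_or -IH (leq_eqVlt m d.+1) ltnS (eq_sym m d.+1).
  have le_t : (count (fun m => m <= d)%N t <= count (fun m => m <= d.+1)%N t)%N.
    by apply: sub_count => k /= kd; exact: leqW.
  have [<-|_] /= := eqVneq d.+1 m; last by rewrite eqn_add2l.
  by rewrite ltnn add0n add1n ltn_eqF.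
have yP (w : 'S_n) : reflect (forall x, block c (w x) = block c x) (w \in young c).
  by rewrite inE; exact: 'forall_eqP.
have yG : group_set (young c).
  apply/group_setP; split; first by apply/yP => x; rewrite perm1.
  by move=> u v /yP uy /yP vy; apply/yP => x; rewrite permM vy uy.
apply/eqP; rewrite eqEsubset; apply/andP; split.
  rewrite (_ : young c = Group yG) // gen_subG; apply/subsetP => _ /imsetP[d dJ ->].
  by apply/yP => x; rewrite /simple; case: tpermP => // ->;
     move: dJ; rewrite -bE => /eqP.
apply/subsetP => w /yP wy; have [u [uJ ->]] := monotone_word mb wy.
rewrite /word_prod big_seq; apply: group_prod => d /(allP uJ).
by rewrite bE => dJ; apply/mem_gen/imset_f.
Qed.

Lemma card_subset_of (c : composition) : (size c).-1 = #|~: subset_of c|.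
Proof.
have gt m (t : seq nat) : all (leq 1) t -> all (ltn m) (scanl addn m t).
  elim: t m => //= a t IH m /andP[a0 t0]; have ma : (m < m + a)%N.
    by rewrite -[X in (X < _)%N]addn0 ltn_add2l.
  by rewrite ma; apply: sub_all (IH _ t0) => x; exact: ltn_trans.
have un m (t : seq nat) : all (leq 1) t -> uniq (scanl addn m t).
  elim: t m => //= a t IH m /andP[_ t0]; rewrite IH // andbT.
  by apply/negP => /(allP (gt _ _ t0)); rewrite /= ltnn.
have ct m (t : seq nat) : all (leq 1) t ->
    count (fun x => x < m + sumn t)%N (scanl addn m t) = (size t).-1.
  elim: t m => //= a t IH m /andP[_ t0]; rewrite addnA IH //.
  case: t t0 {IH} => [|b t] /=; first by rewrite !addn0 ltnn.
  by case/andP=> b0 _; rewrite -[X in (X < _)%N]addn0 ltn_add2l addn_gt0 b0.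
case: c => c /= cP; case/andP: (cP) => c0 /eqP cn.
rewrite -(ct 0%N c c0) add0n cn -size_filter cardE -[RHS](size_map (fun d : 'I_n.-1 => d.+1)).
apply: perm_size; apply: uniq_perm; first by rewrite filter_uniq ?un.
  by rewrite map_inj_uniq ?enum_uniq // => d e [] /val_inj.
move=> x; rewrite mem_filter; apply/andP/mapP => [[xn xc]|[d]].
  case: x xn xc (allP (gt 0%N c c0) x) => [_ xc /(_ xc)//|x xn xc _].
  have xn' : (x < n.-1)%N by case: (n) xn.
  by exists (Ordinal xn') => //; rewrite mem_enum !inE negbK.
by rewrite mem_enum !inE negbK => dc ->; split=> //; exact: ltn_simple.
Qed.

End LNC.

(* The functor phi sends J <-> (n_1, ..., n_k) to J and the generator d_i^J   *)
(* to the basis element of the atomic coset a_i^J.                            *)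
Definition extends_atomic_assignment n
    (phi : functor (LNC n) (atomic_algebroid n)) : Prop :=
  (forall c : composition n, phi c = subset_of c) /\
  (forall (a b : composition n) (g : lnc_gen a b),
     let i := cast_ord (card_subset_of a) (val g) in
     arrow (gen_val (fmap phi (lnc_morphism g)) : @mor (nilCoxeter_algebroid n) _ _) =
     @arrow (nilCoxeter_algebroid n) _ _ (Dbasis (atomic_coset i))).

(* Main.v *)
From HB Require Import structures.
From Stdlib Require Import Eqdep_dec.
From mathcomp Require Import all_boot all_algebra all_fingroup boolp zify.
Require Import Defs.

(* A basis element of D is determined by the maximal element of its double    *)
(* coset, which is w_I * x * w_J (0-Hecke product) for any x in the coset;    *)
(* hence p * q corresponds to the 0-Hecke product of maximal elements, and    *)
(* being reduced is additivity of lengths.  Start from a composition a and    *)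
(* record a permutation of its parts by the list s of their original          *)
(* positions.  Applying the i-th atomic coset to the coset which permutes the *)
(* blocks of a according to s gives 0 if s_i > s_{i+1}, and otherwise the     *)
(* coset of s with the entries i and i+1 exchanged.  This yields the defining *)
(* relations, and shows that reduced words with different s have different    *)
(* images.  By Matsumoto's theorem the words with a given s are all congruent *)
(* in LNC when reduced, and a word which is not reduced is 0, so that reduced *)
(* words span LNC and the functor is faithful.                                *)

Set Implicit Arguments.
Unset Strict Implicit.
Unset Printing Implicit Defensive.

Import GRing.Theory.

(** * Length and the 0-Hecke product *)

(** A double coset is encoded by its maximal element, which [dmaxE] identifies with the star product
    of w_I, any element x of the coset, and w_J. In this encoding [dstar] is the star product
    ([dmax_dstar]) and reducedness is additivity of lengths ([dreduced_lenE]), so that associativity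
    of star makes D a category.

    Fix a composition a and consider the cosets that move whole blocks, the j-th block of b into
    block s_j of a. Such a coset and the list s determine each other ([block_state_coset],
    [block_state_inj]). The maximal element of an atomic coset is w_M, which is an exchange of two
    adjacent blocks times w_J ([longest_merged]). If s_i < s_{i+1}, multiplying by it is reduced and
    exchanges these two entries ([gen_coset_asc]); if s_i > s_{i+1}, it is absorbed and the
    composite in D is 0 ([gen_coset_desc]). Hence atomic cosets act on the lists s as the generators
    of the nilCoxeter algebra act on its standard basis, and the defining relations hold
    ([lnc_rel_eval]).

    For faithfulness, the class of a reduced word in LNC depends only on its list
    ([reduced_term_cong]), and extending a reduced word at a descent gives 0
    ([reduced_term_desc_cls]), so that reduced words span. Sending a basis element of D to the class
    of a reduced word with its list is thus a left inverse of the functor on morphisms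
    ([retract_psiK]). Fullness holds because the atomic cosets are exactly the images of the
    generators ([atomic_targetE], [psi_generated]), and subsets correspond bijectively to
    compositions ([subset_of_inj], [subset_of_surj]). *)

Section Length.
Local Open Scope group_scope.
Variable n : nat.
Implicit Types (x y w : 'S_n) (d e : 'I_n.-1) (u v : seq 'I_n.-1).

Lemma lo_hi_neq d : lo d != hi d.
Proof. by rewrite -val_eqE /=; lia. Qed.

Lemma simpleV d : (simple d)^-1 = simple d.
Proof. exact: tpermV. Qed.

Lemma simpleK d w : simple d * (simple d * w) = w.
Proof. by rewrite mulgA tperm2 mul1g. Qed.

Lemma simpleEv d (a : 'I_n) :
  simple d a = (if a == d :> nat then d.+1 else if a == d.+1 :> nat then d : nat else a) :> nat.
Proof.
rewrite /simple; case: tpermP => [->|->|/eqP + /eqP] /=.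
- by rewrite eqxx.
- by rewrite eqxx; case: eqP => //; lia.
- by rewrite -!val_eqE /= => /negPf -> /negPf ->.
Qed.

Lemma simple_lt d (a b : 'I_n) :
  (a < b)%N -> ~~ ((a == lo d) && (b == hi d)) -> (simple d a < simple d b)%N.
Proof. by rewrite !simpleEv -!val_eqE /=; do ?case: ifP; lia. Qed.

Definition inversions w : {set 'I_n * 'I_n} :=
  [set p : 'I_n * 'I_n | (p.1 < p.2)%N && (w p.2 < w p.1)%N].

(** Exchanging the positions d and d+1 carries the inversions of [w] bijectively onto those of
    [simple d * w] other than the new pair (d, d+1). *)
Lemma inversions_simple d w : (w (lo d) < w (hi d))%N ->
  #|inversions (simple d * w)| = #|inversions w|.+1.
Proof.
move=> asc; pose f (p : 'I_n * 'I_n) := (simple d p.1, simple d p.2).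
have fI : injective f by move=> [a b] [a' b'] [/perm_inj -> /perm_inj ->].
have -> : inversions (simple d * w) = (lo d, hi d) |: f @: inversions w.
  apply/setP=> -[a b]; rewrite !inE /=.
  have fK : f (f (a, b)) = (a, b).
    by rewrite /f /= /simple !tpermK.
  have -> : ((a, b) \in f @: inversions w) = (f (a, b) \in inversions w).
    by rewrite -{1}fK mem_imset.
  rewrite inE /= !permM xpair_eqE.
  have [/andP[/eqP-> /eqP->]|nab] /= := boolP ((a == lo d) && (b == hi d)).
    by rewrite /simple tpermL tpermR asc /= !ltnSn.
  case ab: (a < b)%N => /=; first by rewrite simple_lt.
  apply/esym/negP => /andP[sab].
  have [|nd] := boolP ((simple d a == lo d) && (simple d b == hi d)).
    by case/andP=> /eqP -> /eqP ->; rewrite ltnNge (ltnW asc).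
  by have := simple_lt sab nd; rewrite /simple !tpermK ab.
rewrite cardsU1 card_imset //.
suff -> : (lo d, hi d) \notin f @: inversions w by rewrite add1n.
apply/imsetP=> -[[a b]]; rewrite inE /= => /andP[ab _] [ea eb].
have : (simple d (lo d) < simple d (hi d))%N by rewrite ea eb /simple !tpermK.
by rewrite /simple tpermL tpermR /=; lia.
Qed.

Lemma ascNdesc d w : (w (lo d) < w (hi d))%N = ~~ (w (hi d) < w (lo d))%N.
Proof.
have : w (lo d) != w (hi d) by rewrite (inj_eq perm_inj) lo_hi_neq.
by rewrite -val_eqE /=; lia.
Qed.

(** Increasing on neighbours implies increasing, hence x <= w x for all x; the same bound for the
    inverse gives equality. *)
Lemma no_descent_perm1 w : (forall d, (w (lo d) < w (hi d))%N) -> w = 1.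
Proof.
move=> asc; 
have mono (x y : 'I_n) : (x < y)%N -> (w x < w y)%N.
  move: {2}(y - x)%N (leqnn (y - x)) => k; elim: k y => [|k IH] y le xy; first lia.
  have yp : (y.-1 < n.-1)%N by have := ltn_ord y; lia.
  have hy : hi (Ordinal yp) = y by apply/val_inj => /=; lia.
  have := asc (Ordinal yp); rewrite hy => a1.
  have [e|ne] := eqVneq x (lo (Ordinal yp)); first by rewrite e.
  apply: ltn_trans a1; apply: IH; rewrite /=; first lia.
  by move: ne; rewrite -val_eqE /=; lia.
have ge (v : 'S_n) : (forall x y : 'I_n, (x < y)%N -> (v x < v y)%N) ->
    forall x : 'I_n, (x <= v x)%N.
  move=> mv x; elim: {x}(nat_of_ord x) {-2}x (erefl (nat_of_ord x)) => [|k IH] x ex //; first lia.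
  have xp : (k < n)%N by have := ltn_ord x; lia.
  have := IH (Ordinal xp) erefl; have := mv (Ordinal xp) x; rewrite /= ex => /(_ (ltnSn k)).
  lia.
apply/permP=> x; rewrite perm1; apply/val_inj/eqP; rewrite eqn_leq ge // andbT.
have := ge w^-1 _ (w x); rewrite permK; apply=> a b ab.
rewrite ltnNge leq_eqVlt; apply/negP => /orP[/eqP/val_inj/perm_inj e|].
  by move: ab; rewrite e ltnn.
by move/mono; rewrite !permKV; lia.
Qed.

Lemma word_prod_cons d u : word_prod (d :: u) = simple d * word_prod u.
Proof. by rewrite /word_prod big_cons. Qed.

Lemma word_prod_nil : word_prod [::] = 1 :> 'S_n.
Proof. by rewrite /word_prod big_nil. Qed.

Lemma word_prod_rev u : word_prod (rev u) = (word_prod u)^-1.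
Proof.
elim: u => [|d u IH]; first by rewrite word_prod_nil invg1.
by rewrite rev_cons -cats1 /word_prod big_cat big_seq1 big_cons invMg simpleV -IH.
Qed.

Lemma len_word u : (len (word_prod u) <= size u)%N.
Proof.
rewrite /len; case: ex_minnP => m _; apply.
by apply/existsP; exists (in_tuple u).
Qed.

Lemma size_reduced_word w : size (reduced_word w) = len w.
Proof. by rewrite /reduced_word size_tuple. Qed.

Lemma reduced_wordK w : word_prod (reduced_word w) = w.
Proof. by rewrite /reduced_word; exact/eqP/(xchooseP (existsP (ex_reduced_word w))). Qed.

Lemma ex_descent w : w != 1 -> exists d, (w (hi d) < w (lo d))%N.
Proof.
move=> w1; have [/existsP//|/existsPn nd] := boolP [exists d, (w (hi d) < w (lo d))%N].
by case/eqP: w1; apply: no_descent_perm1 => d; rewrite ascNdesc nd.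
Qed.

Lemma inversions_simple_desc d w : (w (hi d) < w (lo d))%N ->
  #|inversions w| = #|inversions (simple d * w)|.+1.
Proof.
by move=> ds; rewrite -(@inversions_simple d) ?simpleK // !permM /simple tpermL tpermR.
Qed.

(** Removing descents one at a time sorts [w] in as many steps as there are inversions; conversely,
    each letter of a word creates at most one inversion. *)
Lemma lenE w : len w = #|inversions w|.
Proof.
apply/eqP; rewrite eqn_leq; apply/andP; split.
  suff [u <- <-] : exists2 u, word_prod u = w & size u = #|inversions w|.
    exact: len_word.
  elim: {w}#|_| {-2}w (erefl #|inversions w|) => [|m IH] w ew.
    exists [::] => //; rewrite word_prod_nil; apply/esym/eqP; apply: contraT => /ex_descent[d].
    by move/inversions_simple_desc; rewrite ew.
  have [w1|/ex_descent[d ds]] := eqVneq w 1.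
    move: ew; rewrite w1 => /esym e; suff : #|inversions 1| = 0%N by rewrite -e.
    by apply/eqP; rewrite cards_eq0; apply/eqP/setP=> -[a b]; rewrite !inE !perm1 /=; lia.
  have [|u eu su] := IH (simple d * w); first by move: ew; rewrite (inversions_simple_desc ds) => -[].
  by exists (d :: u); rewrite ?word_prod_cons ?eu ?simpleK //= su (inversions_simple_desc ds).
rewrite -size_reduced_word -{1}(reduced_wordK w); elim: (reduced_word w) => [|d u IH].
  by rewrite word_prod_nil leqn0 cards_eq0; apply/eqP/setP=> -[a b]; rewrite !inE !perm1 /=; lia.
rewrite word_prod_cons /=; have [a|] := boolP (word_prod u (lo d) < word_prod u (hi d))%N.
  by rewrite inversions_simple.
by rewrite ascNdesc negbK => /inversions_simple_desc e; rewrite ltnW // -e (leq_trans IH).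
Qed.

Lemma len_asc d w : (w (lo d) < w (hi d))%N -> len (simple d * w) = (len w).+1.
Proof. by rewrite !lenE; exact: inversions_simple. Qed.

Lemma len_desc d w : (w (hi d) < w (lo d))%N -> len w = (len (simple d * w)).+1.
Proof. by rewrite !lenE; exact: inversions_simple_desc. Qed.

Lemma len_lt_simple d w : (len w < len (simple d * w))%N = (w (lo d) < w (hi d))%N.
Proof.
have [a|] := boolP (w (lo d) < w (hi d))%N; first by rewrite len_asc // ltnSn.
by rewrite ascNdesc negbK => /len_desc ->; lia.
Qed.

Lemma len_simple_le d w : (len (simple d * w) <= (len w).+1)%N.
Proof.
have [a|] := boolP (w (lo d) < w (hi d))%N; first by rewrite len_asc.
by rewrite ascNdesc negbK => /len_desc ->; lia.
Qed.

Lemma len1 : len (1 : 'S_n) = 0%N.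
Proof. by apply/eqP; rewrite -leqn0; have := len_word [::]; rewrite word_prod_nil. Qed.

Lemma lenV w : len w^-1 = len w.
Proof.
have le (v : 'S_n) : (len v^-1 <= len v)%N.
  by rewrite -{1}(reduced_wordK v) -word_prod_rev -(size_reduced_word v) -size_rev len_word.
by apply/eqP; rewrite eqn_leq le -{1}(invgK w) le.
Qed.

Lemma len_word_mul u y : (len (word_prod u * y) <= size u + len y)%N.
Proof.
elim: u => [|d u IH]; first by rewrite word_prod_nil mul1g.
by rewrite word_prod_cons -mulgA; apply: leq_trans (len_simple_le _ _) _.
Qed.

Definition desc w d := (w (hi d) < w (lo d))%N.

Lemma star_simpleE d w : star_simple d w = if desc w d then w else simple d * w.
Proof. by rewrite /star_simple len_lt_simple ascNdesc if_neg. Qed.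

End Length.

(** * Associativity of the 0-Hecke product *)

Section Star.
Local Open Scope group_scope.
Variable n : nat.
Implicit Types (x y z w : 'S_n) (d e : 'I_n.-1) (u v : seq 'I_n.-1).

Lemma desc_simple d w : desc (simple d * w) d = ~~ desc w d.
Proof. by rewrite /desc !permM /simple tpermL tpermR ascNdesc. Qed.

(* Exchanging the values e and e+1 does not affect the order of the values at *)
(* d and d+1, unless w maps {d, d+1} to {e, e+1}.                             *)
Lemma desc_mul_simple d e w :
  simple d * w != w * simple e -> desc (w * simple e) d = desc w d.
Proof.
move=> ne; rewrite /desc !permM.
have nlo : ~~ ((w (lo d) == lo e) && (w (hi d) == hi e)).
  apply: contra ne => /andP[/eqP e1 /eqP e2].
  by apply/eqP; rewrite conjgC /simple tpermJ e1 e2.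
have nhi : ~~ ((w (hi d) == lo e) && (w (lo d) == hi e)).
  apply: contra ne => /andP[/eqP e1 /eqP e2].
  by apply/eqP; rewrite conjgC /simple tpermJ e1 e2 tpermC.
have [h|] := boolP (w (hi d) < w (lo d))%N; first exact: simple_lt.
rewrite -ascNdesc => h; have := simple_lt h nlo; lia.
Qed.

Definition rstar_simple e w : 'S_n := (star_simple e w^-1)^-1.

Lemma rstar_simpleE e w : rstar_simple e w = if desc w^-1 e then w else w * simple e.
Proof. by rewrite /rstar_simple star_simpleE; case: ifP; rewrite ?invMg invgK ?simpleV. Qed.

(** If s_d w = w s_e, comparing lengths shows that d is a left descent exactly when e is a right
    descent. Otherwise neither multiplication affects the descent tested by the other
    ([desc_mul_simple]). This commutation makes star independent of words and associative, without
    an appeal to the word property. *)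
Lemma star_simple_comm d e w :
  star_simple d (rstar_simple e w) = rstar_simple e (star_simple d w).
Proof.
have [eq|ne] := eqVneq (simple d * w) (w * simple e).
  have dd : desc w d = desc w^-1 e.
    have h (v : 'S_n) f : desc v f = ~~ (len v < len (simple f * v))%N.
      by rewrite len_lt_simple ascNdesc negbK.
    by rewrite !h eq lenV -(lenV (w * simple e)) invMg simpleV.
  rewrite (rstar_simpleE e w) (star_simpleE d w) dd; case: ifP => dwe.
    by rewrite star_simpleE dd dwe rstar_simpleE dwe.
  rewrite star_simpleE -eq desc_simple dd dwe /=.
  by rewrite rstar_simpleE eq invMg simpleV desc_simple dwe.
have h1 := desc_mul_simple ne.
have h2 : desc (w^-1 * simple d) e = desc w^-1 e.
  apply: desc_mul_simple; apply: contra ne => /eqP h; apply/eqP/invg_inj.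
  by rewrite !invMg !simpleV h.
rewrite rstar_simpleE !star_simpleE (fun_if (fun z => desc z d)) h1 if_same.
case: (desc w d); first by rewrite rstar_simpleE.
rewrite rstar_simpleE invMg simpleV h2.
by case: ifP; rewrite ?mulgA.
Qed.

Definition lstar u y : 'S_n := foldr (@star_simple n) y u.
Definition rstar u x : 'S_n := foldr rstar_simple x u.

Lemma rstarE u x : rstar u x = (lstar u x^-1)^-1.
Proof.
elim: u => [|d u IH]; first by rewrite /= invgK.
by rewrite /= IH /rstar_simple invgK.
Qed.

Lemma lstar_comm u v w : lstar u (rstar v w) = rstar v (lstar u w).
Proof.
have h d : star_simple d (rstar v w) = rstar v (star_simple d w).
  by elim: v => //= e v IH; rewrite star_simple_comm IH.
elim: u => //= d u ->.
by elim: v {h} => //= e v IH; rewrite star_simple_comm IH.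
Qed.

Lemma lstar_reduced u y : len (word_prod u * y) = (size u + len y)%N ->
  lstar u y = word_prod u * y.
Proof.
elim: u => [|d u IH] /=; first by rewrite word_prod_nil mul1g.
rewrite word_prod_cons -mulgA addSn => h.
have le1 := len_word_mul u y; have le2 := len_simple_le d (word_prod u * y).
have e : len (word_prod u * y) = (size u + len y)%N.
  by apply/eqP; rewrite eqn_leq le1 -ltnS -h le2.
by rewrite IH // star_simpleE /desc ltnNge leq_eqVlt -len_lt_simple h e ltnSn orbT.
Qed.

Lemma lstar_reduced1 u x : word_prod u = x -> size u = len x -> lstar u 1 = x.
Proof. by move=> <- s; rewrite lstar_reduced ?mulg1 // s len1 addn0. Qed.

(** Letters that act trivially are dropped; each remaining one raises the length by one. *)
Lemma lstar_subword u y : exists v, [/\ subseq v u, lstar u y = word_prod v * y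
   & len (lstar u y) = (size v + len y)%N].
Proof.
elim: u => [|d u [v [sv ev lv]]]; first by exists [::]; rewrite word_prod_nil mul1g.
rewrite /= star_simpleE; case: ifP => [ds|/negbT nd].
  by exists v; split=> //; exact: subseq_trans sv (subseq_cons _ _).
exists (d :: v); rewrite /= eqxx word_prod_cons -mulgA -ev len_asc ?lv //.
by rewrite ascNdesc.
Qed.

(** Write [y] as right operators applied to 1 and move the left operators past them: only their
    value at 1 matters. Hence star can be computed from any word, reduced or not, with value [x] at
    1. *)
Lemma lstar1_eq u v x y : lstar u 1 = x -> lstar v 1 = x -> lstar u y = lstar v y.
Proof.
move=> ux vx; have ey : rstar (reduced_word y^-1) 1 = y.
  by rewrite rstarE invg1 (@lstar_reduced1 _ y^-1) ?invgK // ?reduced_wordK ?size_reduced_word.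
by rewrite -ey !lstar_comm ux vx.
Qed.

Lemma lstar_reduced_word x : lstar (reduced_word x) 1 = x.
Proof. by apply: lstar_reduced1; rewrite ?reduced_wordK ?size_reduced_word. Qed.

Lemma starE u x y : lstar u 1 = x -> star x y = lstar u y.
Proof. by move=> ux; apply: lstar1_eq (lstar_reduced_word x) ux. Qed.

Lemma starEr u x y : rstar u 1 = y -> star x y = rstar u x.
Proof.
by move=> <-; rewrite (starE _ (lstar_reduced_word x)) lstar_comm lstar_reduced_word.
Qed.

(** With [x] given by left operators and [z] by right operators, this is their commutation at
    [y]. *)
Lemma starA x y z : star (star x y) z = star x (star y z).
Proof.
have [u ux] : exists u, lstar u 1 = x by exists (reduced_word x); exact: lstar_reduced_word.
have [v vz] : exists v, rstar v 1 = z.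
  by exists (reduced_word z^-1); rewrite rstarE invg1 lstar_reduced_word invgK.
by rewrite (starEr _ vz) (starEr _ vz) (starE _ ux) (starE _ ux) lstar_comm.
Qed.

Lemma starg1 x : star x 1 = x.
Proof. by rewrite (@starEr [::]). Qed.

Lemma star_simple1 d : star_simple d 1 = simple d.
Proof. by rewrite star_simpleE /desc !perm1 /= mulg1 ltnNge leqnSn. Qed.

Lemma star_simpleM d y : star (simple d) y = star_simple d y.
Proof. by rewrite (@starE [:: d]) //= star_simple1. Qed.

Lemma starV x y : (star x y)^-1 = star y^-1 x^-1.
Proof.
have yv : rstar (reduced_word y^-1) 1 = y.
  by rewrite rstarE invg1 lstar_reduced_word invgK.
by rewrite (starEr _ yv) rstarE invgK (starE _ (lstar_reduced_word y^-1)).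
Qed.

Lemma star_len_le x y : (len (star x y) <= len x + len y)%N.
Proof.
have [v [sv _ ->]] := lstar_subword (reduced_word x) y.
by rewrite leq_add2r -size_reduced_word size_subseq.
Qed.

(** Star is the product of a subword of a reduced word of [x] with [y], with additive lengths. Both
    conditions force that subword to be the whole word. *)
Lemma star_mulE x y : (star x y == x * y) = (len (star x y) == len x + len y)%N.
Proof.
have [v [sv ev lv]] := lstar_subword (reduced_word x) y.
rewrite -/(star x y) in ev lv; apply/eqP/eqP => [e|e].
  apply/eqP; rewrite eqn_leq star_len_le lv leq_add2r.
  have -> : x = word_prod v by apply: (mulIg y); rewrite -ev.
  exact: len_word.
have : size v == size (reduced_word x) by rewrite size_reduced_word -(eqn_add2r (len y)) -lv; apply/eqP.
by rewrite (size_subseq_leqif sv).2 => /eqP h; apply: etrans ev _; rewrite h reduced_wordK.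
Qed.

End Star.

(** * Parabolic subgroups *)

(** A monotone labelling whose level sets are the orbits of the parabolic subgroup of [I]; it turns
    membership in this subgroup into a pointwise condition. *)
Definition block_function n (I : {set 'I_n.-1}) (b : 'I_n -> nat) : Prop :=
  (forall x y : 'I_n, (x <= y)%N -> (b x <= b y)%N) /\
  (forall d, (b (lo d) == b (hi d)) = (d \in I)).

Section Parabolic.
Local Open Scope group_scope.
Variable n : nat.
Implicit Types (x y z w : 'S_n) (d e : 'I_n.-1) (u v : seq 'I_n.-1).
Implicit Types (I J K M : {set 'I_n.-1}) (b : 'I_n -> nat).

Lemma simple_parabolic I d : d \in I -> simple d \in parabolic I.
Proof. by move=> dI; apply/mem_gen/imset_f. Qed.

Lemma word_parabolic I u : all (mem I) u -> word_prod u \in parabolic I.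
Proof.
move=> /allP uI; rewrite /word_prod big_seq; apply: group_prod => d /uI.
exact: simple_parabolic.
Qed.

Lemma parabolicP I b w : block_function I b ->
  reflect (forall x : 'I_n, b (w x) = b x) (w \in parabolic I).
Proof.
case=> mb bE.
have bG : group_set [set w : 'S_n | [forall x, b (w x) == b x]].
  apply/group_setP; split=> [|u v]; first by rewrite inE; apply/forallP => x; rewrite perm1.
  rewrite !inE => /forallP uP /forallP vP; apply/forallP => x.
  by rewrite permM (eqP (vP _)) (eqP (uP _)).
apply: (iffP idP) => [wI x|wb]; last first.
  have [u [uI ->]] := monotone_word mb wb; apply: word_parabolic.
  by apply: sub_all uI => d; rewrite /= bE.
suff /subsetP/(_ w wI) : parabolic I \subset Group bG by rewrite inE => /forallP/(_ x)/eqP.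
rewrite gen_subG; apply/subsetP => _ /imsetP[d dI ->].
rewrite inE; apply/forallP => z; rewrite /simple.
by case: tpermP => // ->; move: dI; rewrite -bE // => /eqP ->.
Qed.

Definition cuts_before I (x : 'I_n) : nat := #|[set d : 'I_n.-1 | (d \notin I) && (d < x)%N]|.

Lemma cuts_before_block I : block_function I (cuts_before I).
Proof.
split=> [x y xy|d].
  by apply/subset_leq_card/subsetP => d; rewrite !inE => /andP[-> /leq_trans->].
have -> : cuts_before I (hi d) = ((d \notin I) + cuts_before I (lo d))%N.
  rewrite /cuts_before (cardsD1 d) !inE ltnSn andbT; congr (_ + _)%N.
  apply: eq_card => e; rewrite !inE -val_eqE /=; case: (e \notin I); lia.
by case: (d \in I); rewrite ?eqxx //= add1n; apply/negbTE; rewrite neq_ltn ltnSn.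
Qed.

(** A descent of [w] lies in [I] because [w] preserves the blocks of [I], so sorting by descents
    never leaves the parabolic subgroup. *)
Lemma parabolic_word I w : w \in parabolic I ->
  exists u, [/\ all (mem I) u, word_prod u = w & size u = len w].
Proof.
have bI := cuts_before_block I; have [mb bE] := bI.
move: {2}(len w) (erefl (len w)) => m; elim: m w => [|m IH] w lw wI;
  have [->|/ex_descent[d ds]] := eqVneq w 1.
- by exists [::]; rewrite word_prod_nil len1.
- by move: lw; rewrite (len_desc ds).
- by exists [::]; rewrite word_prod_nil len1.
have dI : d \in I.
  rewrite -bE eqn_leq mb //= -(parabolicP _ bI wI (hi d)) -(parabolicP _ bI wI (lo d)).
  by rewrite mb // ltnW.
have [||u [uI uw su]] := IH (simple d * w).
- by move: lw; rewrite (len_desc ds) => -[].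
- by rewrite groupMl // simple_parabolic.
by exists (d :: u); rewrite /= dI uI word_prod_cons uw simpleK (len_desc ds) su.
Qed.

Lemma star_parabolic I x y : x \in parabolic I ->
  exists2 z, z \in parabolic I & star x y = z * y.
Proof.
case/parabolic_word => u [uI ux su].
have [v [vu ev _]] := lstar_subword u y; exists (word_prod v).
  by apply: word_parabolic; apply/allP => d /(mem_subseq vu)/(allP uI).
by rewrite -ev; apply/starE/lstar_reduced1.
Qed.

Lemma longest_parabolic I : longest I \in parabolic I.
Proof. by rewrite /longest; case: arg_maxnP. Qed.

Lemma len_longest I w : w \in parabolic I -> (len w <= len (longest I))%N.
Proof. by rewrite /longest; case: arg_maxnP => // v _; apply. Qed.

Lemma star_simple_longest I d : d \in I -> star (simple d) (longest I) = longest I.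
Proof.
move=> dI; rewrite star_simpleM /star_simple ltnNge len_longest //.
by rewrite groupM ?simple_parabolic ?longest_parabolic.
Qed.

Lemma star_longest_simple I d : d \in I -> star (longest I) (simple d) = longest I.
Proof.
move=> dI; apply: invg_inj; rewrite starV simpleV star_simpleM /star_simple ltnNge.
rewrite -{1}[simple d]simpleV -invMg !lenV len_longest //.
by rewrite groupM ?simple_parabolic ?longest_parabolic.
Qed.

Lemma star_absorb I x y : (forall d, d \in I -> star (simple d) y = y) ->
  x \in parabolic I -> star x y = y.
Proof.
move=> yI /parabolic_word[u [uI ux su]].
rewrite (starE _ (lstar_reduced1 ux su)); elim: u uI {ux su} => //= d u IH /andP[dI /IH->].
by rewrite -star_simpleM yI.
Qed.

Lemma star_longest_absorb I w : w \in parabolic I -> star w (longest I) = longest I.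
Proof. by apply: star_absorb => d; exact: star_simple_longest. Qed.

(** For d in [I], w_I absorbs s_d on its right, so its star product with z does not change under
    [star_simple d]; and y and s_d y have the same image under [star_simple d], the longer of the
    two. *)
Lemma star_longest_mul I (u x : 'S_n) : u \in parabolic I ->
  star (longest I) (u * x) = star (longest I) x.
Proof.
case/parabolic_word=> v [vI <- _]; elim: v vI => [|d v IH] /=; first by rewrite word_prod_nil mul1g.
case/andP=> dI /IH <-; rewrite word_prod_cons -mulgA; set y := _ * x.
have h z : star (longest I) z = star (longest I) (star_simple d z).
  by rewrite -star_simpleM -starA star_longest_simple.
have [a|] := boolP (desc y d); last first.
  by move=> nd; rewrite (h y) star_simpleE (negPf nd).
by rewrite h star_simpleE desc_simple a simpleK.
Qed.

Definition left_desc I w := forall d, d \in I -> desc w d.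

Lemma left_descP I w : left_desc I w <-> star (longest I) w = w.
Proof.
split=> [wI|wI d dI].
  apply: star_absorb (longest_parabolic I) => d dI.
  by rewrite star_simpleM star_simpleE wI.
have : star_simple d w = w by rewrite -star_simpleM -{1}wI -starA star_simple_longest.
rewrite star_simpleE; case: ifP => // _ /(congr1 (fun v : 'S_n => v (lo d))).
by rewrite permM /simple tpermL => /perm_inj /eqP; rewrite eq_sym (negPf (lo_hi_neq d)).
Qed.

Lemma left_desc_longest I : left_desc I (longest I).
Proof. by apply/left_descP/star_longest_absorb/longest_parabolic. Qed.

(** The star product of w_I with its inverse is that inverse by absorption, and is w_I by
    [star_longest_mul]. *)
Lemma longestV I : (longest I)^-1 = longest I.
Proof.
have h : star (longest I) (longest I)^-1 = (longest I)^-1.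
  apply: star_absorb (longest_parabolic I) => d dI.
  by rewrite -[simple d]simpleV -starV star_longest_simple.
by rewrite -h -[in LHS](mulg1 (longest I)^-1) star_longest_mul ?starg1 // groupV longest_parabolic.
Qed.

Lemma parabolicS I M : I \subset M -> parabolic I \subset parabolic M.
Proof. by move=> IM; apply/genS/imsetS. Qed.

Lemma star_longestS I M : I \subset M -> star (longest I) (longest M) = longest M.
Proof.
move=> IM; apply: star_longest_absorb.
by apply: (subsetP (parabolicS IM)); exact: longest_parabolic.
Qed.

Lemma star_longestSr I M : I \subset M -> star (longest M) (longest I) = longest M.
Proof. by move=> IM; apply: invg_inj; rewrite starV !longestV star_longestS. Qed.

(** Removing a factor w_I on the right does not change the star product with w_I, which returns [w].
    This star product is then an ordinary product, so lengths add. *)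
Lemma star_longestK I w : star w (longest I) = w ->
  star (w * (longest I)^-1) (longest I) = w /\
  len w = (len (w * (longest I)^-1) + len (longest I))%N.
Proof.
move=> h; have e : star (w * (longest I)^-1) (longest I) = w.
  apply: invg_inj; rewrite starV invMg invgK longestV star_longest_mul ?longest_parabolic //.
  by rewrite -[in RHS]h starV longestV.
split=> //; rewrite -{1}e; apply/eqP; rewrite -star_mulE e.
by rewrite mulgKV.
Qed.

End Parabolic.

(** * Double cosets and the nilCoxeter algebroid *)

(* Otherwise unification tries to evaluate these by enumerating finite types. *)
#[local] Opaque len longest parabolic.

Section DoubleCosets.
Local Open Scope group_scope.
Variable n : nat.
Implicit Types (x y z w : 'S_n) (d e : 'I_n.-1) (I J K M : {set 'I_n.-1}).

Lemma star_longest_mulr J x (v : 'S_n) : v \in parabolic J ->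
  star (x * v) (longest J) = star x (longest J).
Proof.
move=> vJ; apply: invg_inj; rewrite !starV !longestV invMg star_longest_mul //.
by rewrite groupV.
Qed.

Lemma bruhat_star_simple d x : bruhat x (star_simple d x).
Proof.
rewrite /star_simple; case: ifP => [lt|_]; last exact: connect0.
(* A left factor s_d is the reflection x^-1 s_d x as a right factor, the side on which [bruhat_step]
   multiplies. *)
apply/connect1/existsP; exists (simple d ^ x).
rewrite lt andbT -conjgC eqxx andbT.
by apply/existsP; exists d; apply/existsP; exists x.
Qed.

Lemma bruhat_rstar_simple d x : bruhat x (rstar_simple d x).
Proof.
rewrite /rstar_simple /star_simple; case: ifP => [lt|_]; last by rewrite invgK; exact: connect0.
apply/connect1/existsP; exists (simple d); rewrite -lenV (leq_trans lt) ?lenV // andbT.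
rewrite invMg invgK simpleV eqxx andbT.
by apply/existsP; exists d; apply/existsP; exists 1; rewrite conjg1.
Qed.

Lemma bruhat_star x y : bruhat y (star x y).
Proof.
rewrite /star; elim: (reduced_word x) => [|d u IH] /=; first exact: connect0.
exact: connect_trans IH (bruhat_star_simple _ _).
Qed.

Lemma bruhat_starr x y : bruhat x (star x y).
Proof.
rewrite (@starEr _ (reduced_word y^-1)); last by rewrite rstarE invg1 lstar_reduced_word invgK.
elim: (reduced_word _) => [|d u IH] /=; first exact: connect0.
exact: connect_trans IH (bruhat_rstar_simple _ _).
Qed.

Lemma bruhat_len x y : bruhat x y -> (x == y) || (len x < len y)%N.
Proof.
case/connectP=> s; elim: s x => [|z s IH] x /=; first by move=> _ ->; rewrite eqxx.
case/andP=> /existsP[t /and3P[_ _ lt]] pz ey.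
by have /orP[/eqP <-|/(ltn_trans lt) ->] := IH z pz ey; rewrite ?lt orbT.
Qed.

Lemma bruhat_anti x y : bruhat x y -> bruhat y x -> x = y.
Proof.
move=> /bruhat_len/orP[/eqP//|xy] /bruhat_len/orP[/eqP//|yx].
by have := ltn_trans xy yx; rewrite ltnn.
Qed.

Lemma double_cosetP I J w x :
  reflect (exists u v : 'S_n, [/\ u \in parabolic I, v \in parabolic J & x = u * w * v])
    (x \in double_coset I w J).
Proof.
apply: (iffP mulsgP) => [[y v /rcosetP[u uI ->] vJ ->]|[u [v [uI vJ ->]]]].
  by exists u, v.
by exists (u * w) v => //; apply/rcosetP; exists u.
Qed.

Lemma double_coset_refl I J w : w \in double_coset I w J.
Proof. by apply/double_cosetP; exists 1, 1; rewrite !group1 mul1g mulg1. Qed.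

Lemma double_coset_eq I J w x : x \in double_coset I w J ->
  double_coset I x J = double_coset I w J.
Proof.
case/double_cosetP=> u [v [uI vJ ->]]; apply/setP => y; apply/double_cosetP/double_cosetP.
  case=> u' [v' [u'I v'J ->]]; exists (u' * u), (v * v').
  by rewrite !groupM // !mulgA.
case=> u' [v' [u'I v'J ->]]; exists (u' * u^-1), (v^-1 * v').
by rewrite !groupM ?groupV // !mulgA mulgKV mulgK.
Qed.

Lemma mem_dcoset_of I J w : w \in dcoset_set (dcoset_of I J w).
Proof. exact: double_coset_refl. Qed.

Lemma dcoset_of_mem I J (p : dcoset I J) x : x \in dcoset_set p -> dcoset_of I J x = p.
Proof.
case: p => s sP /= xs; apply/val_inj => /=; case/existsP: (sP) => w /eqP e.
by rewrite e; apply: double_coset_eq; rewrite -e.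
Qed.

(** The Bruhat-maximal element of the double coset of [x]: it depends only on the coset, lies in it,
    and is above every [x] in it, as the next lemmas show. *)
Definition hull I J x := star (star (longest I) x) (longest J).

Lemma hull_double_coset I J w x : x \in double_coset I w J -> hull I J x = hull I J w.
Proof.
case/double_cosetP=> u [v [uI vJ ->]].
by rewrite /hull -mulgA star_longest_mul // starA star_longest_mulr // -starA.
Qed.

Lemma hull_mem I J x : hull I J x \in double_coset I x J.
Proof.
have [u uI e] := star_parabolic x (longest_parabolic I).
have [v vJ e'] := star_parabolic (u * x)^-1 (longest_parabolic J).
apply/double_cosetP; exists u, v^-1; rewrite groupV; split=> //.
by apply: invg_inj; rewrite /hull e starV longestV e' [RHS]invMg invgK.
Qed.

Lemma bruhat_hull I J x : bruhat x (hull I J x).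
Proof. exact: connect_trans (bruhat_star _ _) (bruhat_starr _ _). Qed.

Lemma dmaxE I J (p : dcoset I J) x : x \in dcoset_set p -> dmax p = hull I J x.
Proof.
move=> xp; have e := dcoset_of_mem xp; have hp : hull I J x \in dcoset_set p.
  by rewrite -e; exact: hull_mem.
have hm y : y \in dcoset_set p -> bruhat y (hull I J x).
  by rewrite -e => /hull_double_coset <-; exact: bruhat_hull.
rewrite /dmax; case: pickP => [w /andP[wp /'forall_implyP wm]|/(_ (hull I J x))].
  by apply: bruhat_anti; [exact: hm | exact: wm].
by rewrite hp /= => /negP[]; apply/'forall_implyP => y; exact: hm.
Qed.

#[local] Opaque dmax star.

Lemma dmax_of I J w : dmax (dcoset_of I J w) = hull I J w.
Proof. exact/dmaxE/mem_dcoset_of. Qed.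

Lemma dmax_mem I J (p : dcoset I J) : dmax p \in dcoset_set p.
Proof.
case: p => s sP; case/existsP: (sP) => w /eqP e.
have ws : w \in dcoset_set (DCoset sP) by rewrite /= e double_coset_refl.
by rewrite (dmaxE ws); move: (hull_mem I J w); rewrite -e.
Qed.

Lemma dmaxK I J (p : dcoset I J) : dcoset_of I J (dmax p) = p.
Proof. exact/dcoset_of_mem/dmax_mem. Qed.

Lemma dmax_inj I J : injective (@dmax n I J).
Proof. by move=> p q e; rewrite -(dmaxK p) e dmaxK. Qed.

Lemma star_longest_dmax I J (p : dcoset I J) : star (longest I) (dmax p) = dmax p.
Proof.
rewrite (dmaxE (dmax_mem p)) /hull -starA -(starA (longest I)).
by rewrite (star_longest_absorb (longest_parabolic I)).
Qed.

Lemma star_dmax_longest I J (p : dcoset I J) : star (dmax p) (longest J) = dmax p.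
Proof.
rewrite (dmaxE (dmax_mem p)) /hull starA.
by rewrite (star_longest_absorb (longest_parabolic J)).
Qed.

(** The star product of the two maximal elements is already stable under w_I on the left and w_K on
    the right, hence is its own hull. *)
Lemma dmax_dstar I J K (p : dcoset I J) (q : dcoset J K) :
  dmax (dstar p q) = star (dmax p) (dmax q).
Proof. by rewrite dmax_of /hull -starA star_longest_dmax starA star_dmax_longest. Qed.

(* With x = dmax p * (longest J)^-1, both conditions say that the product of  *)
(* x and dmax q has additive lengths.                                         *)
Lemma star_dmaxE I J K (p : dcoset I J) (q : dcoset J K) :
  star (dmax p) (dmax q) = star (dmax p * (longest J)^-1) (dmax q).
Proof.
have [e _] := star_longestK (star_dmax_longest p).
by rewrite -{1}e starA star_longest_dmax.
Qed.

Lemma dreducedE I J K (p : dcoset I J) (q : dcoset J K) :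
  dreduced p q = (star (dmax p) (dmax q) == dmax p * (longest J)^-1 * dmax q).
Proof.
rewrite /dreduced; apply: andb_idr; rewrite star_dmaxE star_mulE => /eqP ->.
by rewrite (star_longestK (star_dmax_longest p)).2 addnAC.
Qed.

Lemma dreduced_lenE I J K (p : dcoset I J) (q : dcoset J K) :
  dreduced p q = (len (star (dmax p) (dmax q)) + len (longest J) == len (dmax p) + len (dmax q))%N.
Proof.
rewrite /dreduced; apply: andb_idl; rewrite (star_longestK (star_dmax_longest p)).2 addnAC.
by rewrite eqn_add2r star_dmaxE -star_mulE.
Qed.

Lemma dstar_len_le I J K (p : dcoset I J) (q : dcoset J K) :
  (len (dmax (dstar p q)) + len (longest J) <= len (dmax p) + len (dmax q))%N.
Proof.
rewrite dmax_dstar (star_longestK (star_dmax_longest p)).2 addnAC leq_add2r star_dmaxE.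
exact: star_len_le.
Qed.

Lemma dstarA I J K M (p : dcoset I J) (q : dcoset J K) (r : dcoset K M) :
  dstar p (dstar q r) = dstar (dstar p q) r.
Proof. by apply: dmax_inj; rewrite !dmax_dstar starA. Qed.

#[local] Opaque dstar.

(** Both sides say that lengths add up over the triple product: [dstar_len_le] bounds every partial
    product, so equality for the whole forces equality for the parts in either bracketing. *)
Lemma dreducedA I J K M (p : dcoset I J) (q : dcoset J K) (r : dcoset K M) :
  dreduced q r && dreduced p (dstar q r) = dreduced p q && dreduced (dstar p q) r.
Proof.
have aux (p' q' r' j k pq qr pqr : nat) : (pq + j <= p' + q' -> qr + k <= q' + r' ->
    pqr + j <= p' + qr -> pqr + k <= pq + r' ->
    (qr + k == q' + r') && (pqr + j == p' + qr) =
    (pq + j == p' + q') && (pqr + k == pq + r'))%N by lia.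
have a3 := dstar_len_le p (dstar q r); rewrite !dreduced_lenE -!dmax_dstar dstarA in a3 *.
exact: (aux _ _ _ _ _ _ _ _ (dstar_len_le p q) (dstar_len_le q r) a3
  (dstar_len_le (dstar p q) r)).
Qed.

Lemma dmax1 I : dmax (dcoset_of I I 1) = longest I.
Proof. by rewrite dmax_of /hull starg1 star_longestS. Qed.

Lemma dstar1l I J (p : dcoset I J) : dstar (dcoset_of I I 1) p = p.
Proof. by apply: dmax_inj; rewrite dmax_dstar dmax1 star_longest_dmax. Qed.

Lemma dstar1r I J (p : dcoset I J) : dstar p (dcoset_of J J 1) = p.
Proof. by apply: dmax_inj; rewrite dmax_dstar dmax1 star_dmax_longest. Qed.

Lemma dreduced1l I J (p : dcoset I J) : dreduced (dcoset_of I I 1) p.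
Proof. by rewrite dreduced_lenE dmax1 star_longest_dmax addnC. Qed.

Lemma dreduced1r I J (p : dcoset I J) : dreduced p (dcoset_of J J 1).
Proof. by rewrite dreduced_lenE dmax1 star_dmax_longest. Qed.

End DoubleCosets.

#[local] Opaque dmax star dstar dreduced.

(** * The category laws of the nilCoxeter algebroid *)

Section NilCoxeter.
Local Open Scope ring_scope.
Variable n : nat.
Implicit Types (I J K M : {set 'I_n.-1}).

Lemma DcompDl K J I (f1 f2 : Dhom J I) (g : Dhom K J) :
  Dcomp (f1 + f2) g = Dcomp f1 g + Dcomp f2 g.
Proof.
rewrite /Dcomp -big_split; apply: eq_bigr => p _; rewrite -big_split; apply: eq_bigr => q _ /=.
by rewrite ffunE mulrDl mulrzDr.
Qed.

Lemma DcompDr K J I (f : Dhom J I) (g1 g2 : Dhom K J) :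
  Dcomp f (g1 + g2) = Dcomp f g1 + Dcomp f g2.
Proof.
rewrite /Dcomp -big_split; apply: eq_bigr => p _; rewrite -big_split; apply: eq_bigr => q _ /=.
by rewrite ffunE mulrDr mulrzDr.
Qed.

Lemma Dcomp_basisE K J I (p : dcoset I J) (q : dcoset J K) :
  Dcomp (Dbasis p) (Dbasis q) = Dcomp_basis p q.
Proof.
rewrite /Dcomp (big_only1 p) //; last first.
  by move=> p' np _; rewrite big1 // => q' _; rewrite (ffunE _ p') (negPf np) mul0r mulr0z.
rewrite (big_only1 q) //; last first.
  by move=> q' nq _; rewrite (ffunE _ q') (negPf nq) mulr0 mulr0z.
by rewrite !ffunE !eqxx mulr1 mulr1z.
Qed.

Lemma Dhom_sum J I (f : Dhom J I) :
  f = \sum_(p : dcoset I J) Dbasis p *~ (f : {ffun _ -> _}) p.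
Proof.
apply/ffunP => q; rewrite sum_ffunE (bigD1 q) //= big1 ?addr0 => [|p np].
  by rewrite -[X in _ = X]/((Dbasis q *~ _) q) ffunMzE ffunE eqxx -mulrzr mul1r intz.
by rewrite ffunMzE ffunE eq_sym (negPf np) mul0rz.
Qed.

Lemma additive_basis J I (V : zmodType) (F G : Dhom J I -> V) :
  (forall f g, F (f + g) = F f + F g) -> (forall f g, G (f + g) = G f + G g) ->
  (forall p, F (Dbasis p) = G (Dbasis p)) -> F =1 G.
Proof.
have aux (H : Dhom J I -> V) (HD : forall f g, H (f + g) = H f + H g) f :
    H f = \sum_(p : dcoset I J) H (Dbasis p) *~ (f : {ffun _ -> _}) p.
  have H0 : H 0 = 0 by apply: (addrI (H 0)); rewrite -HD !addr0.
  have HN g : H (- g) = - H g by apply/eqP; rewrite -addr_eq0 -HD addNr H0.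
  have HMn g k : H (g *+ k) = H g *+ k by elim: k => // k IH; rewrite !mulrS HD IH.
  have HM g (k : int) : H (g *~ k) = H g *~ k.
    by case: k => k; rewrite ?NegzE ?mulrNz ?HN -!pmulrn HMn.
  rewrite {1}(Dhom_sum f) (big_morph H HD H0); apply: eq_bigr => p _; exact: HM.
by move=> FD GD e f; rewrite (aux F) // (aux G) //; apply: eq_bigr => p _; rewrite e.
Qed.

Lemma Dcomp0l K J I (g : Dhom K J) : Dcomp (0 : Dhom J I) g = 0.
Proof. by apply: (addrI (Dcomp 0 g)); rewrite -DcompDl !addr0. Qed.

Lemma Dcomp0r K J I (f : Dhom J I) : Dcomp f (0 : Dhom K J) = 0.
Proof. by apply: (addrI (Dcomp f 0)); rewrite -DcompDr !addr0. Qed.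

Lemma nilCoxeter_is_algebroid : is_algebroid (nilCoxeter_algebroid n).
Proof.
split=> /=.
- move=> a b c d h g f.
  apply: (@additive_basis _ _ _ (fun h => Dcomp h _) (fun h => Dcomp (Dcomp h _) _)) h => [||r].
  + by move=> *; rewrite DcompDl.
  + by move=> *; rewrite !DcompDl.
  apply: (@additive_basis _ _ _ (fun g => Dcomp _ (Dcomp g _)) (fun g => Dcomp (Dcomp _ g) _)) g => [||q].
  + by move=> *; rewrite DcompDl DcompDr.
  + by move=> *; rewrite DcompDr DcompDl.
  apply: (@additive_basis _ _ _ (fun f => Dcomp _ (Dcomp _ f)) (fun f => Dcomp _ f)) f => [||p].
  + by move=> *; rewrite !DcompDr.
  + by move=> *; rewrite DcompDr.
  (* On basis elements each side is a basis element or 0; [dreducedA] says that they are nonzero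
     together, and [dstarA] that they then agree. *)
  rewrite !Dcomp_basisE /Dcomp_basis; have := dreducedA r q p.
  case: (dreduced q p); case: (dreduced r q);
    rewrite ?andTb ?andFb ?Dcomp_basisE /Dcomp_basis ?Dcomp0l ?Dcomp0r ?dstarA.
  + by move=> ->.
  + by move=> ->.
  + by move=> <-.
  + by [].
- move=> a b f; apply: (@additive_basis _ _ _ (fun f => Dcomp _ f) id) f => [||p] //.
  + by move=> *; rewrite DcompDr.
  by rewrite Dcomp_basisE /Dcomp_basis dreduced1l dstar1l.
- move=> a b f; apply: (@additive_basis _ _ _ (fun f => Dcomp f _) id) f => [||p] //.
  + by move=> *; rewrite DcompDl.
  by rewrite Dcomp_basisE /Dcomp_basis dreduced1r dstar1r.
- by move=> *; exact: DcompDl.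
- by move=> *; exact: DcompDr.
Qed.

End NilCoxeter.

(** * Algebroids *)

Section Algebroids.
Local Open Scope ring_scope.
Implicit Types (C D : algebroid_data).

(** Injectivity of dependent pairs holds over objects with decidable equality, here supplied
    classically by [pselect]. *)
Lemma arrow_inj C (a b : C) (f g : mor a b) : arrow f = arrow g -> f = g.
Proof.
have dec (x y : C) : {x = y} + {x <> y} by exact: pselect.
by move=> h; have {}h := inj_pair2_eq_dec _ dec _ _ _ _ h; exact: inj_pair2_eq_dec _ dec _ _ _ _ h.
Qed.

Lemma mcomp0l C (a b c : C) (f : mor a b) : is_algebroid C -> mcomp (0 : mor b c) f = 0.
Proof. by move=> hC; apply: (addrI (mcomp 0 f)); rewrite -(compDl hC) !addr0. Qed.

Lemma mcompNl C (a b c : C) (g : mor b c) (f : mor a b) :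
  is_algebroid C -> mcomp (- g) f = - mcomp g f.
Proof.
by move=> hC; apply/eqP; rewrite -addr_eq0 -(compDl hC) addNr mcomp0l.
Qed.

Lemma mcomp_is_zmod C (a b c : C) (g : mor b c) : is_algebroid C ->
  zmod_morphism (fun f : mor a b => mcomp g f).
Proof.
move=> hC f f'; apply: (addIr (mcomp g f')); rewrite -(compDr hC) subrK addrNK.
by [].
Qed.

Lemma generated_is_algebroid C (G : forall a b : C, mor a b -> Prop) :
  is_algebroid C -> is_algebroid (generated_subalgebroid G).
Proof.
by case=> hA h1 h2 hl hr; split=> * /=; apply/val_inj => /=.
Qed.

Definition cast_mor C (x x' y y' : C) (ex : x = x') (ey : y = y') (f : mor x y) : mor x' y' :=
  eq_rect y (mor x') (eq_rect x (fun z => mor z y) f x' ex) y' ey.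

Lemma arrow_cast C (x x' y y' : C) (ex : x = x') (ey : y = y') (f : mor x y) :
  arrow (cast_mor ex ey f) = arrow f.
Proof. by case: _ / ex; case: _ / ey. Qed.

Lemma cast_mor_id C (x y : C) (ex : x = x) (ey : y = y) (f : mor x y) : cast_mor ex ey f = f.
Proof. by apply: arrow_inj; rewrite arrow_cast. Qed.

Lemma cast_morB C (x x' y y' : C) (ex : x = x') (ey : y = y') (f g : mor x y) :
  cast_mor ex ey (f - g) = cast_mor ex ey f - cast_mor ex ey g.
Proof. by case: _ / ex; case: _ / ey. Qed.

Lemma cast_idm C (x x' : C) (e e' : x = x') : cast_mor e e' (idm x) = idm x'.
Proof. by case: _ / e e' => e'; exact: cast_mor_id. Qed.

Lemma cast_mcomp C (x x' y y' z z' : C) (ex : x = x') (ey : y = y') (ez : z = z')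
    (g : mor y z) (f : mor x y) :
  cast_mor ex ez (mcomp g f) = mcomp (cast_mor ey ez g) (cast_mor ex ey f).
Proof. by case: _ / ex; case: _ / ey; case: _ / ez. Qed.

(** The inverse functor chooses preimages of objects and morphisms. A chosen object maps to the
    given one only up to the equality [goK], so morphisms are transported along it, which [arrow]
    does not see. *)
Lemma isomorphism_criterion C D (F : functor C D) :
  injective (fobj F) -> (forall x, exists a, F a = x) ->
  (forall a b : C, injective (@fmap _ _ F a b)) ->
  (forall (a b : C) (g : mor (F a) (F b)), exists f, fmap F f = g) ->
  is_isomorphism F.
Proof.
move=> Finj Fsurj faith full.
pose go x := projT1 (cid (Fsurj x)); pose goK x : F (go x) = x := projT2 (cid (Fsurj x)).
pose gm x y (g : mor x y) : mor (go x) (go y) :=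
  projT1 (cid (full _ _ (cast_mor (esym (goK x)) (esym (goK y)) g))).
have gmK x y (g : mor x y) : fmap F (gm x y g) = cast_mor (esym (goK x)) (esym (goK y)) g.
  exact: projT2 (cid (full _ _ _)).
have gmB x y : zmod_morphism (gm x y).
  by move=> f g; apply: faith; rewrite raddfB !gmK cast_morB.
pose ga x y : {additive mor x y -> mor (go x) (go y)} :=
  HB.pack (gm x y) (GRing.isZmodMorphism.Build _ _ (gm x y) (gmB x y)).
have gmid x : ga x x (idm x) = idm (go x).
  by apply: faith; rewrite /= gmK fmap_id cast_idm.
have gmcomp x y z (g : mor y z) (f : mor x y) : ga x z (mcomp g f) = mcomp (ga y z g) (ga x y f).
  by apply: faith; rewrite /= fmap_comp !gmK; exact: cast_mcomp.
exists (Functor gmid gmcomp); split=> [a b f|x y g] /=; last by rewrite gmK arrow_cast.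
(* Injectivity on objects identifies the chosen end points with the original ones; only then can
   faithfulness be applied. *)
have aux a' b' (f' : mor a' b') (ea : F a = F a') (eb : F b = F b') :
    fmap F f' = cast_mor ea eb (fmap F f) -> arrow f' = arrow f.
  move=> h; have ea' := Finj _ _ ea; have eb' := Finj _ _ eb.
  case: _ / ea' in f' ea h *; case: _ / eb' in f' eb h *.
  by congr arrow; apply: faith; rewrite h cast_mor_id.
exact: aux (gmK _ _ _).
Qed.

(** * The universal property of a presented category *)

Section PresentedFunctor.
Variables (O : Type) (gen : O -> O -> Type).
Variable rel : forall a b, term gen a b -> term gen a b -> Prop.
Variables (D : algebroid_data) (D_alg : is_algebroid D) (fo : O -> D).
Variable fg : forall a b, gen a b -> mor (fo a) (fo b).

Fixpoint term_eval a b (t : term gen a b) : mor (fo a) (fo b) :=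
  match t in term _ a b return mor (fo a) (fo b) with
  | t_gen a b g => fg g
  | t_id a => idm (fo a)
  | t_comp a b c g f => mcomp (term_eval g) (term_eval f)
  | t_zero a b => 0
  | t_opp a b f => - term_eval f
  | t_add a b f g => term_eval f + term_eval g
  end.

Hypothesis rel_eval : forall a b (f g : term gen a b), rel f g -> term_eval f = term_eval g.

Lemma cong_eval a b (f g : term gen a b) : cong rel f g -> term_eval f = term_eval g.
Proof.
elim=> {a b f g} //=.
- by move=> a b f g h _ -> _ ->.
- by move=> a b c g g' f f' _ -> _ ->.
- by move=> a b f f' _ ->.
- by move=> a b f f' g g' _ -> _ ->.
- by move=> *; rewrite addrA.
- by move=> *; rewrite addrC.
- by move=> *; rewrite add0r.
- by move=> *; rewrite addNr.
- by move=> *; exact: compA.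
- by move=> *; exact: compid1.
- by move=> *; exact: compid2.
- by move=> *; exact: compDl.
- by move=> *; exact: compDr.
Qed.

Definition presented_map a b (f : presented_hom rel a b) : mor (fo a) (fo b) :=
  term_eval (rep f).

Lemma presented_mapE a b (t : term gen a b) : presented_map (cls rel t) = term_eval t.
Proof. exact/cong_eval/cong_rep. Qed.

Lemma presented_map_additive a b : zmod_morphism (@presented_map a b).
Proof.
move=> f g; rewrite -(repK f) -(repK g) [- cls _ _]p_oppE [cls _ _ + _]p_addE.
by rewrite !presented_mapE.
Qed.

HB.instance Definition _ a b :=
  GRing.isZmodMorphism.Build (presented_hom rel a b) (mor (fo a) (fo b)) (@presented_map a b)
    (@presented_map_additive a b).

Lemma presented_map_id a : presented_map (p_id rel a) = idm (fo a).
Proof. exact: presented_mapE. Qed.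

Lemma presented_map_comp a b c (g : presented_hom rel b c) (f : presented_hom rel a b) :
  presented_map (p_comp g f) = mcomp (presented_map g) (presented_map f).
Proof. by rewrite -(repK f) -(repK g) p_compE !presented_mapE. Qed.

Definition presented_functor : functor (presented_algebroid rel) D :=
  @Functor (presented_algebroid rel) D fo
    (fun a b => @presented_map a b : {additive presented_hom rel a b -> mor (fo a) (fo b)})
    presented_map_id presented_map_comp.

End PresentedFunctor.
End Algebroids.

(** * Compositions and blocks *)

(** Needed to match the i-th complementary element counted by [enum_val] with the i-th partial
    sum. *)
Lemma sorted_succ_enum m (A : {set 'I_m}) : sorted ltn [seq d.+1 | d : 'I_m <- enum A].
Proof.
rewrite sorted_map (@eq_sorted _ _ (relpre val ltn)) //.
rewrite /enum_mem sorted_filter => [|x y z|]; [by []|exact: ltn_trans|].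
by rewrite -sorted_map -enumT val_enum_ord iota_ltn_sorted.
Qed.

Section SwapParts.
Implicit Types (s t : seq nat) (i j l : nat).

Definition adj_swap i j : nat := if j == i then i.+1 else if j == i.+1 then i else j.

Lemma size_swap_parts s i : (i.+1 < size s)%N -> size (swap_parts s i) = size s.
Proof. by move=> h; rewrite /swap_parts !size_cat /= size_drop size_takel; lia. Qed.

Lemma nth_swap_parts s i j : (i.+1 < size s)%N ->
  nth 0%N (swap_parts s i) j = nth 0%N s (adj_swap i j).
Proof.
move=> h; rewrite /swap_parts /adj_swap nth_cat size_takel; last lia.
have [ji|ij] := ltnP j i; first by rewrite nth_take // !ifF //; lia.
have [->|ne] := eqVneq j i; first by rewrite subnn.
have [->|ne'] := eqVneq j i.+1; first by rewrite subSnn.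
have -> : (j - i = (j - i.+2).+2)%N by lia.
by rewrite /= nth_drop; congr nth; lia.
Qed.

Lemma perm_swap_parts s i : (i.+1 < size s)%N -> perm_eq (swap_parts s i) s.
Proof.
move=> h; have es : s = take i s ++ [:: nth 0%N s i; nth 0%N s i.+1] ++ drop i.+2 s.
  by rewrite -[LHS](cat_take_drop i) (drop_nth 0%N (ltnW h)) (drop_nth 0%N h).
by rewrite [X in perm_eq _ X]es /swap_parts perm_cat2l perm_cat2r (perm_catC [:: _] [:: _]).
Qed.

Definition psum s j : nat := sumn (take j s).

Lemma psum0 s : psum s 0 = 0%N.
Proof. by rewrite /psum take0. Qed.

Lemma psumS s j : psum s j.+1 = (psum s j + nth 0%N s j)%N.
Proof.
rewrite /psum; have [h|h] := ltnP j (size s); first by rewrite (take_nth 0%N h) sumn_rcons.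
by rewrite nth_default // !take_oversize //; lia.
Qed.

Lemma psum_le s j l : (j <= l)%N -> (psum s j <= psum s l)%N.
Proof.
by move=> h; rewrite -(subnK h); elim: (_ - _)%N => // k IH; rewrite addSn psumS; lia.
Qed.

Lemma psum_swap_parts s i j : (i.+1 < size s)%N -> j != i.+1 ->
  psum (swap_parts s i) j = psum s j.
Proof.
move=> h; have lt l : (l <= i)%N -> psum (swap_parts s i) l = psum s l.
  elim: l => [|l IH] li; first by rewrite !psum0.
  by rewrite !psumS IH 1?ltnW // nth_swap_parts // /adj_swap !ifF //; lia.
have [ji _|ij ne] := leqP j i; first exact: lt.
have -> : (j = (j - i.+2) + i.+2)%N by lia.
elim: (j - _)%N => [|k IH]; last first.
  by rewrite addSn !psumS IH nth_swap_parts // /adj_swap !ifF //; lia.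
rewrite add0n !psumS lt // !nth_swap_parts // /adj_swap eqxx ifF ?eqxx; lia.
Qed.

Lemma psum_swap_parts1 s i : (i.+1 < size s)%N ->
  psum (swap_parts s i) i.+1 = (psum s i + nth 0%N s i.+1)%N.
Proof.
move=> h; rewrite psumS psum_swap_parts ?nth_swap_parts // /adj_swap ?eqxx //; lia.
Qed.

Lemma partial_sumsE s : partial_sums s = [seq psum s j.+1 | j <- iota 0 (size s)].
Proof.
apply: (@eq_from_nth _ 0%N) => [|j]; first by rewrite size_scanl size_map size_iota.
rewrite size_scanl => js; rewrite (nth_map 0%N) ?size_iota // nth_iota // add0n.
rewrite /partial_sums /psum -[RHS]add0n.
have aux (t : seq nat) m l : (l < size t)%N ->
    nth 0%N (scanl addn m t) l = (m + sumn (take l.+1 t))%N.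
  elim: t m l => //= a t IH m [|l] h /=; first by rewrite take0 addn0.
  by rewrite IH // addnA.
exact: aux.
Qed.

End SwapParts.

Section Blocks.
Variables (n : nat) (c : composition n).
Implicit Types (x y : 'I_n) (d : 'I_n.-1) (i j : nat).

Lemma part_gt0 j : (j < size c)%N -> (0 < nth 0%N c j)%N.
Proof. by case: c => p /= /andP[/all_nthP h _]; apply: h. Qed.

Lemma sumn_composition : sumn c = n.
Proof. by case: c => p /= /andP[_ /eqP]. Qed.

Lemma psum_size : psum c (size c) = n.
Proof. by rewrite /psum take_size sumn_composition. Qed.

Lemma psum_lt j l : (j < l)%N -> (l <= size c)%N -> (psum c j < psum c l)%N.
Proof.
move=> jl lc; apply: leq_trans (psum_le c jl).
by rewrite psumS; have := part_gt0 (leq_trans jl lc); lia.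
Qed.

Lemma blockE x j : (j < size c)%N -> (psum c j <= x < psum c j.+1)%N -> block c x = j.
Proof.
move=> jc /andP[jx xj]; rewrite /block partial_sumsE count_map.
rewrite -(subnKC (ltnW jc)) iotaD count_cat add0n.
rewrite (eq_in_count (a2 := predT)) => [|l]; last first.
  by rewrite mem_iota /= => h; apply/idP; apply: leq_trans jx; exact: psum_le.
rewrite count_predT size_iota (eq_in_count (a2 := pred0)) ?count_pred0 ?addn0 // => l.
rewrite mem_iota /= => /andP[h _]; apply/negbTE; rewrite -ltnNge.
by apply: leq_trans xj _; apply: psum_le.
Qed.

Lemma blockP x : (block c x < size c)%N /\ (psum c (block c x) <= x < psum c (block c x).+1)%N.
Proof.
have ex : exists j, (x < psum c j)%N by exists (size c); rewrite psum_size.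
case: (ex_minnP ex) => -[|j]; first by rewrite psum0.
move=> xj jmin; have jc : (j < size c)%N by apply: jmin; rewrite psum_size.
have jx : (psum c j <= x)%N by rewrite leqNgt; apply/negP => /jmin; rewrite ltnn.
by rewrite (@blockE x j) // jx.
Qed.

Lemma block_cut d j : (j.+1 < size c)%N -> d.+1 = psum c j.+1 ->
  block c (lo d) = j /\ block c (hi d) = j.+1.
Proof.
move=> jc e; have h1 := psum_lt (ltnSn j) (ltnW jc); have h2 := psum_lt (ltnSn j.+1) jc.
by split; apply: blockE => //=; rewrite -?e; lia.
Qed.

(** The last partial sum n does not occur, because d+1 < n. *)
Lemma subset_ofPn d :
  reflect (exists2 j, (j.+1 < size c)%N & d.+1 = psum c j.+1) (d \notin subset_of c).
Proof.
rewrite inE negbK partial_sumsE; apply: (iffP mapP) => -[j].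
  rewrite mem_iota add0n => /andP[_ jc] e; exists j => //.
  rewrite ltn_neqAle jc andbT; apply/eqP => ej.
  by move: e; rewrite ej psum_size; have := ltn_simple d; lia.
by move=> jc e; exists j => //; rewrite mem_iota /= ltnW.
Qed.

Lemma block_function_block : block_function (subset_of c) (block c).
Proof.
split=> [x y xy|d]; first by apply: sub_count => m /= mx; exact: leq_trans mx xy.
apply/eqP/idP => [e|dc].
  apply/negPn/negP => /subset_ofPn[j jc ed].
  by have [] := block_cut jc ed; rewrite e => -> /eqP; rewrite eqn_leq ltnn andbF.
apply: contraTeq dc => ne; apply/subset_ofPn.
have [h1 /andP[h2 h3]] := blockP (hi d); have [k1 /andP[k2 k3]] := blockP (lo d).
have le : (block c (lo d) < block c (hi d))%N.
  by rewrite ltn_neqAle ne; apply: sub_count => m /= mx; exact: leq_trans mx (leqnSn _).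
move: h1 h2 le; case: (block c (hi d)) => // j h1 h2 le; exists j => //.
by have := psum_le c le; move: k3 h2 => /=; lia.
Qed.

(** Both lists are strictly increasing and have the same members. *)
Lemma enum_cuts : [seq (d : 'I_n.-1).+1 | d <- enum (~: subset_of c)] =
  [seq psum c j.+1 | j <- iota 0 (size c).-1].
Proof.
apply: (@irr_sorted_eq _ ltn) => [||||]; [exact: ltn_trans|exact: ltnn| | |].
- exact: sorted_succ_enum.
- apply/(sortedP 0%N) => j; rewrite size_map size_iota => jc.
  rewrite !(nth_map 0%N) ?size_iota ?nth_iota ?(ltnW jc) //.
  by apply: psum_lt => //; lia.
move=> x; apply/mapP/mapP => [[d]|[j]].
  rewrite mem_enum inE => /subset_ofPn[j jc e] ->; exists j => //.
  by rewrite mem_iota; lia.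
rewrite mem_iota add0n => /andP[_ jc] ->; have jc' : (j.+1 < size c)%N by lia.
have h := psum_lt jc' (leqnn _); rewrite psum_size in h.
have h0 := psum_lt (ltn0Sn j) (ltnW jc'); rewrite psum0 in h0.
have h' : ((psum c j.+1).-1 < n.-1)%N by lia.
exists (Ordinal h') => /=; last by lia.
by rewrite mem_enum inE; apply/subset_ofPn; exists j => //=; lia.
Qed.

Lemma enum_val_cut (i : 'I_(size c).-1) :
  (enum_val (cast_ord (card_subset_of c) i)).+1 = psum c i.+1.
Proof.
have d0 := enum_val (cast_ord (card_subset_of c) i).
have := congr1 (fun s => nth 0%N s i) enum_cuts; rewrite (nth_map d0); last first.
  by rewrite -cardE -card_subset_of.
rewrite (nth_map 0%N) ?size_iota // nth_iota // add0n => <-.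
by rewrite (enum_val_nth d0).
Qed.

(** The total n closes the list, except for n = 0, where the only composition is empty and has no
    partial sums. *)
Lemma partial_sums_cuts : partial_sums c =
  [seq (d : 'I_n.-1).+1 | d <- enum (~: subset_of c)] ++ nseq (0 < n)%N n.
Proof.
rewrite enum_cuts partial_sumsE; case: (posnP (size c)) => [s0|s0].
  suff -> : (0 < n)%N = false by rewrite s0.
  by rewrite -psum_size s0 psum0.
have n0 : (0 < n)%N by rewrite -psum_size -(psum0 c) psum_lt.
by rewrite n0 -(prednK s0) -addn1 iotaD map_cat /= add0n addn1 prednK // psum_size.
Qed.

End Blocks.

(** The subset gives the partial sums, and their consecutive differences give back the parts. *)
Lemma subset_of_inj n : injective (@subset_of n).
Proof.
move=> a b e; have : partial_sums a = partial_sums b by rewrite !partial_sums_cuts e.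
have K : forall x, cancel (addn x) (subn^~ x) by move=> x y; rewrite addKn.
move/(congr1 (pairmap (fun x y => y - x)%N 0%N)); rewrite /partial_sums.
by rewrite !(@scanlK _ _ (fun x y => y - x)%N addn) // => /val_inj.
Qed.

Lemma pairmap_subn m l : path ltn m l ->
  [/\ scanl addn m (pairmap (fun x y => y - x)%N m l) = l,
      all (leq 1) (pairmap (fun x y => y - x)%N m l) &
      (m + sumn (pairmap (fun x y => y - x)%N m l))%N = last m l].
Proof.
elim: l m => [|x l IH] m /=; first by rewrite addn0.
case/andP=> mx /IH[e1 e2 e3]; rewrite addnA subnKC ?(ltnW mx) // e1 e3 e2 subn_gt0 mx.
by [].
Qed.

Lemma subset_of_surj n (J : {set 'I_n.-1}) : exists c : composition n, subset_of c = J.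
Proof.
(* The parts will be the consecutive differences of the cuts, with n appended when n is positive. *)
pose L := [seq d.+1 | d : 'I_n.-1 <- enum (~: J)]; pose l := L ++ nseq (0 < n)%N n.
have Lb x : x \in L -> (0 < x < n)%N by case/mapP=> d _ ->; exact: ltn_simple.
have lastL : (last 0%N L < n)%N || (n == 0%N).
  by have := mem_last 0%N L; rewrite inE => /orP[/eqP->|/Lb/andP[_ ->]] //; rewrite lt0n orNb.
have pl : path ltn 0%N l.
  rewrite cat_path path_min_sorted ?sorted_succ_enum; last by apply/allP => x /Lb/andP[].
  by case: (posnP n) lastL => [->//|n0]; rewrite orbF => /= ->.
have [e1 e2 e3] := pairmap_subn pl; rewrite add0n in e3.
have ll : last 0%N l = n.
  rewrite last_cat; case: (posnP n) => [n0|] //=.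
  have := mem_last 0%N L; rewrite inE => /orP[/eqP->|/Lb] //.
  by rewrite n0 ltn0 andbF.
have cP : all (leq 1) (pairmap (fun x y => y - x)%N 0%N l) &&
    (sumn (pairmap (fun x y => y - x)%N 0%N l) == n) by rewrite e2 e3 ll eqxx.
exists (Composition cP); apply/setP => d; rewrite inE /partial_sums /= e1 mem_cat mem_nseq.
rewrite [d.+1 == n]ltn_eqF ?ltn_simple // andbF orbF mem_map => [|x y [] /val_inj//].
by rewrite mem_enum inE negbK.
Qed.

(** * Descents inside blocks and merging of blocks *)

Section BlockFunctions.
Local Open Scope group_scope.
Variable n : nat.
Implicit Types (I J : {set 'I_n.-1}) (f : 'I_n -> nat) (w : 'S_n).

Lemma block_function_inj I J f g : f =1 g -> block_function I f -> block_function J g -> I = J.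
Proof. by move=> fg [_ fE] [_ gE]; apply/setP => d; rewrite -fE -gE !fg. Qed.

Lemma desc_block I f w : block_function I f -> left_desc I w ->
  forall x y : 'I_n, (x < y)%N -> f x = f y -> (w y < w x)%N.
Proof.
case=> fm fE wI x y; move: {2}(y - x)%N (leqnn (y - x)) => k.
elim: k y => [|k IH] y le xy fxy; first lia.
have yp : (y.-1 < n.-1)%N by have := ltn_ord y; lia.
have hy : hi (Ordinal yp) = y by apply/val_inj => /=; lia.
have xlo : (x <= lo (Ordinal yp))%N by rewrite /=; lia.
have flo : f (lo (Ordinal yp)) = f y.
  apply/eqP; rewrite eqn_leq -{2}fxy (fm _ _ xlo) andbT; apply: fm => /=; lia.
have dI : Ordinal yp \in I by rewrite -fE hy flo.
have := wI _ dI; rewrite /desc hy => lt.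
have [<-//|ne] := eqVneq (lo (Ordinal yp)) x.
apply: ltn_trans lt _; apply: IH; rewrite ?flo //=; first lia.
by move: ne; rewrite -val_eqE /=; lia.
Qed.

(** Labels above i drop by one, so that the blocks i and i+1, separated only by the cut d, receive a
    common label. *)
Lemma block_function_merge I f d i :
  block_function I f -> f (lo d) = i -> f (hi d) = i.+1 ->
  block_function (d |: I) (fun x => f x - (i < f x))%N.
Proof.
case=> fm fE flo fhi; split=> [x y /fm|e].
  by case: (ltnP i (f x)); case: (ltnP i (f y)); lia.
rewrite in_setU1 -fE.
have le : (f (lo e) <= f (hi e))%N by apply: fm => /=.
have -> : (e == d) = (f (lo e) == i) && (f (hi e) == i.+1).
  apply/eqP/andP => [->|[/eqP e1 /eqP e2]]; first by rewrite flo fhi.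
  apply/val_inj; case: (ltngtP (val e) (val d)) => // lt; last first.
    by have := fm (hi d) (lo e) lt; rewrite e1 fhi ltnn.
  by have := fm (hi e) (lo d) lt; rewrite e2 flo ltnn.
by move: le; case: (ltnP i (f (lo e))); case: (ltnP i (f (hi e))); lia.
Qed.

End BlockFunctions.

(** The exchange of two adjacent intervals starting at [A], increasing on each: their sizes in order
    are m2, m1 in the source and m1, m2 in the target. *)
Definition swap_points (A m1 m2 x : nat) : nat :=
  if (x < A)%N then x else if (x < A + m2)%N then x + m1
  else if (x < A + m1 + m2)%N then x - m2 else x.

Lemma swap_pointsK A m1 m2 : cancel (swap_points A m1 m2) (swap_points A m2 m1).
Proof. by move=> x; rewrite /swap_points; do ?case: ifP; lia. Qed.

Lemma swap_points_lt A m1 m2 n x : (A + m1 + m2 <= n)%N -> (x < n)%N ->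
  (swap_points A m1 m2 x < n)%N.
Proof. by rewrite /swap_points; do ?case: ifP; lia. Qed.

(** * The effect of w_M on permutations of blocks *)

Section BlockSwap.
Local Open Scope group_scope.
Variables (n : nat) (b c : composition n) (i : nat).
Hypotheses (ib : (i.+1 < size b)%N) (bc : c = swap_parts b i :> seq nat).
Implicit Types (x y : 'I_n) (d : 'I_n.-1).

Let A := psum b i.
Let m1 := nth 0%N b i.
Let m2 := nth 0%N b i.+1.

Let Abound : (A + m1 + m2 <= n)%N.
Proof. by rewrite /A /m1 /m2 -!psumS -[X in (_ <= X)%N](psum_size b); exact: psum_le. Qed.

Let sc : size c = size b.
Proof. by rewrite bc size_swap_parts. Qed.

Definition block_swap_fun x : 'I_n := insubd x (swap_points A m1 m2 x).

Lemma block_swap_funE x : block_swap_fun x = swap_points A m1 m2 x :> nat.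
Proof. by rewrite /block_swap_fun insubdK // unfold_in swap_points_lt. Qed.

Lemma block_swap_fun_inj : injective block_swap_fun.
Proof.
move=> x y /(congr1 val) /=; rewrite !block_swap_funE => /(can_inj (@swap_pointsK _ _ _)).
exact: val_inj.
Qed.

(* Maps the positions of the blocks of [c] to those of [b].                   *)
Definition block_swap : 'S_n := perm block_swap_fun_inj.

Lemma block_swapE x : block_swap x = swap_points A m1 m2 x :> nat.
Proof. by rewrite permE block_swap_funE. Qed.

Let psc j : j != i.+1 -> psum c j = psum b j.
Proof. by rewrite bc; exact: psum_swap_parts. Qed.

Let psc1 : psum c i.+1 = (A + m2)%N.
Proof. by rewrite bc psum_swap_parts1. Qed.

Let psb1 : psum b i.+1 = (A + m1)%N. Proof. by rewrite psumS. Qed.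
Let psb2 : psum b i.+2 = (A + m1 + m2)%N. Proof. by rewrite !psumS. Qed.

Lemma block_block_swap x : block b (block_swap x) = adj_swap i (block c x).
Proof.
have [jc jx] := blockP c x; rewrite sc in jc; move: jc jx; move: (block c x) => j jc jx.
have sw := block_swapE x.
apply: blockE; first by rewrite /adj_swap; do ?case: ifP; lia.
rewrite sw /adj_swap /swap_points; move: jx.
have [->|ne] := eqVneq j i; first by rewrite psc ?psc1 ?psb1 ?psb2 -/A; [do ?case: ifP; lia|lia].
have [->|ne1] := eqVneq j i.+1.
  by rewrite psc1 psc ?psb2 ?psb1 -/A; [do ?case: ifP; lia|lia].
have ne2 : j.+1 != i.+1 by [].
rewrite (psc ne1) (psc ne2).
have [ji|ij] := ltnP j i; first by have := psum_le b ji; rewrite -/A; do ?case: ifP; lia.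
have := @psum_le b i.+2 j; rewrite psb2; do ?case: ifP; lia.
Qed.

Lemma block_swap_lt x y : (x < y)%N -> block c x = block c y ->
  (block_swap x < block_swap y)%N.
Proof.
move=> xy e; have [_ jx] := blockP c x; have [_ jy] := blockP c y.
move: jx jy; rewrite -e !block_swapE; move: (block c x) => j {e}.
rewrite /swap_points.
have [->|ne] := eqVneq j i; first by rewrite psc ?psc1 -/A; [do ?case: ifP; lia|lia].
have [->|ne1] := eqVneq j i.+1; first by rewrite psc1 psc ?psb2 -/A; [do ?case: ifP; lia|lia].
have ne2 : j.+1 != i.+1 by [].
rewrite (psc ne1) (psc ne2).
have [ji|ij] := ltnP j i; first by have := psum_le b ji; rewrite -/A; do ?case: ifP; lia.
have := @psum_le b i.+2 j; rewrite psb2; do ?case: ifP; lia.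
Qed.

Let merge j : nat := (j - (i < j))%N.

Let merge_swap j : merge (adj_swap i j) = merge j.
Proof. by rewrite /merge /adj_swap; case: eqP => [->|_]; [lia|case: eqP => [->|_]; lia]. Qed.

(** The partial sums of [b] and [c] differ only at index i+1, which is the cut that merging
    erases. *)
Let merge_blockE x : merge (block b x) = merge (block c x).
Proof.
have [jb jx] := blockP b x; have [jc kx] := blockP c x; rewrite sc in jc.
have [lt|le] := ltnP x A.
  have ji : (block b x < i)%N.
    by rewrite ltnNge; apply/negP => h; have := psum_le b h; rewrite -/A; lia.
  congr merge; apply/esym/blockE; rewrite ?sc //.
  by rewrite !psc //; lia.
have [lt2|le2] := ltnP x (A + m1 + m2)%N.
  have hb : block b x = i \/ block b x = i.+1.
    have [h|h] := ltnP x (psum b i.+1).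
      by left; apply: blockE; rewrite ?(ltnW ib) //= le h.
    by right; apply: blockE => //; rewrite h psb2.
  have hc : block c x = i \/ block c x = i.+1.
    have [h|h] := ltnP x (psum c i.+1).
      by left; apply: blockE; rewrite ?sc ?(ltnW ib) //= psc ?le ?h //; lia.
    by right; apply: blockE; rewrite ?sc //= h psc ?psb2 //; lia.
  by rewrite /merge; case: hb => ->; case: hc => ->; lia.
have ji : (i.+1 < block b x)%N.
  rewrite ltnNge; apply/negP => h; have := @psum_le b (block b x).+1 i.+2 h; rewrite psb2; lia.
congr merge; apply/esym/blockE; rewrite ?sc //.
by rewrite !psc //; lia.
Qed.

Variables (db dc : 'I_n.-1).
Hypotheses (edb : db.+1 = psum b i.+1) (edc : dc.+1 = psum c i.+1).

Let M := db |: subset_of b.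

Let ic : (i.+1 < size c)%N. Proof. by rewrite sc. Qed.

Let bM : block_function M (fun x => merge (block b x)).
Proof. by apply: block_function_merge (block_function_block b) _ _; have [] := block_cut ib edb. Qed.

Let cM : block_function (dc |: subset_of c) (fun x => merge (block c x)).
Proof. by apply: block_function_merge (block_function_block c) _ _; have [] := block_cut ic edc. Qed.

Lemma merged_subsetE : dc |: subset_of c = M.
Proof. by apply: block_function_inj cM bM => x; rewrite merge_blockE. Qed.

Lemma block_swap_parabolic : block_swap \in parabolic M.
Proof. by apply/(parabolicP _ bM) => x; rewrite block_block_swap merge_swap merge_blockE. Qed.

Variables (a : composition n) (s : seq nat) (w : 'S_n).
Hypothesis bw : forall x, block a (w x) = nth 0%N s (block b x).
Hypothesis wb : left_desc (subset_of b) w.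

Let block_ltW x y : (block a x < block a y)%N -> (x < y)%N.
Proof. by apply: contraTltn => h; rewrite -leqNgt; apply: (block_function_block a).1. Qed.

(** The block exchange lies in W_M, so w_M has the same star product with [w] and with
    [block_swap * w]. The latter already has all descents in M: at the new cut because s_i <
    s_{i+1}, and inside the blocks of [c] because the exchange is increasing there and [w] is
    decreasing on the blocks of [b]. *)
Lemma star_block_swap : (nth 0%N s i < nth 0%N s i.+1)%N ->
  star (longest M) w = block_swap * w.
Proof.
move=> lt; rewrite -(star_longest_mul _ block_swap_parabolic); apply/left_descP => d.
rewrite -merged_subsetE in_setU1 /desc !permM => /predU1P[->|dc'].
  apply: block_ltW.
  by have [e1 e2] := block_cut ic edc; rewrite !bw !block_block_swap e1 e2 /adj_swap !eqxx ifF ?lt //; lia.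
have e : block c (lo d) = block c (hi d) by apply/eqP; rewrite (block_function_block c).2.
apply: (desc_block (block_function_block b) wb); last by rewrite !block_block_swap e.
exact: block_swap_lt.
Qed.

(** Across the cut of [b], the entries of [s] already decrease, so multiplying by w_M will have no
    effect. *)
Lemma left_desc_merged : (nth 0%N s i.+1 < nth 0%N s i)%N -> left_desc M w.
Proof.
move=> lt d; rewrite in_setU1 /desc => /predU1P[->|]; last exact: wb.
apply: block_ltW.
by have [e1 e2] := block_cut ib edb; rewrite !bw e1 e2.
Qed.

End BlockSwap.

(** * Reduced words in the labeled nilCoxeter algebroid *)

Section SwapPartsBraid.
Implicit Types (s : seq nat) (i j : nat).

Lemma swap_partsK s i : (i.+1 < size s)%N -> swap_parts (swap_parts s i) i = s.
Proof.
move=> h; apply: (@eq_from_nth _ 0%N) => [|j _]; first by rewrite !size_swap_parts.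
rewrite !nth_swap_parts ?size_swap_parts //; congr nth.
by rewrite /adj_swap; do ?case: ifP; lia.
Qed.

Lemma swap_parts_far s i j : (i.+1 < size s)%N -> (j.+1 < size s)%N -> (i.+1 < j)%N ->
  swap_parts (swap_parts s i) j = swap_parts (swap_parts s j) i.
Proof.
move=> hi hj ij; apply: (@eq_from_nth _ 0%N) => [|l _]; first by rewrite !size_swap_parts ?size_swap_parts.
rewrite !nth_swap_parts ?size_swap_parts //; congr nth.
by rewrite /adj_swap; do ?case: ifP; lia.
Qed.

Lemma swap_parts_braid s i : (i.+2 < size s)%N ->
  swap_parts (swap_parts (swap_parts s i) i.+1) i =
  swap_parts (swap_parts (swap_parts s i.+1) i) i.+1.
Proof.
move=> h; have h' := ltnW h; apply: (@eq_from_nth _ 0%N) => [|l _].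
  by rewrite !size_swap_parts ?size_swap_parts.
rewrite !nth_swap_parts ?size_swap_parts //; congr nth.
by rewrite /adj_swap; do ?case: ifP; lia.
Qed.

Lemma map_swap_parts (f : nat -> nat) s i : (i.+1 < size s)%N ->
  map f (swap_parts s i) = swap_parts (map f s) i.
Proof.
move=> h; rewrite /swap_parts map_cat /= map_take map_drop.
by rewrite !(nth_map 0%N) // ltnW.
Qed.

Fixpoint seq_inversions s : nat :=
  if s is x :: r then count (fun y => y < x)%N r + seq_inversions r else 0.

Lemma seq_inversions_swap s i : (i.+1 < size s)%N -> (nth 0 s i < nth 0 s i.+1)%N ->
  seq_inversions (swap_parts s i) = (seq_inversions s).+1.
Proof.
elim: i s => [|i IH] [|x s] //.
  case: s => [|y s] //= _ xy; rewrite /swap_parts /= drop0 xy.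
  by rewrite (ltnNge y x) (ltnW xy) /=; lia.
move=> h lt; have e : swap_parts (x :: s) i.+1 = x :: swap_parts s i by [].
by rewrite e /= IH // (seq.permP (perm_swap_parts (h : (i.+1 < size s)%N))) addnS.
Qed.

End SwapPartsBraid.

(** * Words in the generators and Matsumoto's theorem *)

Section ReducedTerms.
Variable n : nat.
Implicit Types (a b c : composition n) (s : seq nat) (i j : nat).
Notation lterm := (term (@lnc_gen n)).
Notation lcong := (cong (@lnc_rel n)).

Lemma lnc_idx_lt b c (g : lnc_gen b c) : ((lnc_idx g).+1 < size b)%N.
Proof. exact: ltn_simple. Qed.

Lemma lnc_gen_target b c (g : lnc_gen b c) : c = swap_parts b (lnc_idx g) :> seq nat.
Proof. by rewrite /lnc_idx; case: g => i /= /eqP ->. Qed.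

Lemma lnc_idx_inj b c : injective (@lnc_idx n b c).
Proof. by move=> g g' /val_inj /val_inj. Qed.

Lemma ex_lnc_gen b c i : (i.+1 < size b)%N -> c = swap_parts b i :> seq nat ->
  exists g : lnc_gen b c, lnc_idx g = i.
Proof.
move=> h e; have h' : (i < (size b).-1)%N by lia.
have e' : c == swap (Ordinal h') by apply/eqP/val_inj.
by exists (exist _ (Ordinal h') e').
Qed.

(* A composite of generators which permutes the parts of [a] by a reduced     *)
(* word; [s] lists the original positions of the parts in their new order.    *)
Inductive reduced_term a : forall b, seq nat -> lterm a b -> Prop :=
| reduced_id : reduced_term (iota 0 (size a)) (t_id _ a)
| reduced_comp b c s (t : lterm a b) (g : lnc_gen b c) :
    reduced_term s t -> (nth 0%N s (lnc_idx g) < nth 0%N s (lnc_idx g).+1)%N ->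
    reduced_term (swap_parts s (lnc_idx g)) (t_comp (t_gen g) t).

Lemma reduced_term_state a b s (t : lterm a b) : reduced_term s t ->
  perm_eq s (iota 0 (size a)) /\ map (nth 0%N a) s = b.
Proof.
elim=> {b s t} [|b c s t g _ [ps es] _].
  by rewrite perm_refl map_nth_iota0 // take_size.
have h : ((lnc_idx g).+1 < size s)%N by rewrite -(size_map (nth 0%N a)) es lnc_idx_lt.
split; first by rewrite (perm_trans (perm_swap_parts h)).
by rewrite map_swap_parts // es -lnc_gen_target.
Qed.

Lemma reduced_term_size a b s (t : lterm a b) : reduced_term s t -> size s = size b.
Proof. by case/reduced_term_state=> _ <-; rewrite size_map. Qed.

(** Inversion of [reduced_term]; in the identity case the target is itself constrained, so the
    equality is between packed terms. *)
Lemma reduced_term_case a b s (t : lterm a b) : reduced_term s t ->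
  (s = iota 0 (size a) /\ existT (fun b => lterm a b) b t = existT _ a (t_id _ a)) \/
  exists b' s' (t' : lterm a b') (g : lnc_gen b' b), [/\ reduced_term s' t',
    (nth 0%N s' (lnc_idx g) < nth 0%N s' (lnc_idx g).+1)%N,
    s = swap_parts s' (lnc_idx g) & t = t_comp (t_gen g) t'].
Proof. by case=> {b s t} [|b c s t g rt lt]; [left | right; exists b, s, t, g]. Qed.

Lemma reduced_term_step a b c s (t : lterm a b) i : reduced_term s t ->
  (i.+1 < size s)%N -> (nth 0%N s i < nth 0%N s i.+1)%N ->
  map (nth 0%N a) (swap_parts s i) = c ->
  exists2 g : lnc_gen b c, lnc_idx g = i & reduced_term (swap_parts s i) (t_comp (t_gen g) t).
Proof.
move=> rt h lt e; have [_ es] := reduced_term_state rt.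
have [||g gi] := @ex_lnc_gen b c i; first by rewrite -es size_map.
  by rewrite -e map_swap_parts // es.
by exists g => //; rewrite -gi; apply: reduced_comp; rewrite ?gi.
Qed.

Lemma uniq_swap_asc k s i : perm_eq s (iota 0 k) -> (i.+1 < size s)%N ->
  (nth 0%N s i < nth 0%N s i.+1)%N = ~~ (nth 0%N s i.+1 < nth 0%N s i)%N.
Proof.
move=> ps h; have us : uniq s by rewrite (perm_uniq ps) iota_uniq.
have : nth 0%N s i != nth 0%N s i.+1 by rewrite nth_uniq ?(ltnW h) //; lia.
by lia.
Qed.

Lemma reduced_term_up a b s (t : lterm a b) i : reduced_term s t ->
  (i.+1 < size s)%N -> (nth 0%N s i < nth 0%N s i.+1)%N ->
  exists c (g : lnc_gen b c), lnc_idx g = i /\ reduced_term (swap_parts s i) (t_comp (t_gen g) t).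
Proof.
move=> rt h lt; have [_ es] := reduced_term_state rt.
have h' : (i < (size b).-1)%N by rewrite -es size_map; lia.
have [|g gi rg] := @reduced_term_step a b (swap (Ordinal h')) s t i rt h lt.
  by rewrite map_swap_parts // es.
by exists (swap (Ordinal h')), g.
Qed.

Lemma seq_inversions_desc s i : (i.+1 < size s)%N -> (nth 0%N s i.+1 < nth 0%N s i)%N ->
  seq_inversions s = (seq_inversions (swap_parts s i)).+1.
Proof.
move=> h lt; rewrite -{1}(swap_partsK h) seq_inversions_swap ?size_swap_parts //.
by rewrite !nth_swap_parts // /adj_swap !eqxx ifF //; lia.
Qed.

(** Bubble sort: undo descents until the list is increasing, hence the identity list, and read the
    letters backwards. *)
Lemma ex_reduced_term a s : perm_eq s (iota 0 (size a)) ->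
  exists b (t : lterm a b), reduced_term s t.
Proof.
move: {2}(seq_inversions s) (leqnn (seq_inversions s)) => m.
elim: m s => [|m IH] s le ps;
  have [/hasP[i]|/hasPn nd] := boolP (has (fun i => nth 0%N s i.+1 < nth 0%N s i)%N
    (iota 0 (size s).-1)).
1,3: rewrite mem_iota => /andP[_ hi] ds; have h : (i.+1 < size s)%N by lia.
- by move: le; rewrite (seq_inversions_desc h ds).
- have [||b [t rt]] := IH (swap_parts s i).
  + by move: le; rewrite (seq_inversions_desc h ds).
  + by apply: perm_trans ps; exact: perm_swap_parts.
  have [||c [g [_ rg]]] := @reduced_term_up _ _ _ _ i rt; first by rewrite size_swap_parts.
    by rewrite !nth_swap_parts // /adj_swap !eqxx ifF //; lia.
  by exists c, (t_comp (t_gen g) t); rewrite -(swap_partsK h).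
all: suff -> : s = iota 0 (size a) by exists a, (t_id _ a); exact: reduced_id.
all: apply: (@irr_sorted_eq _ ltn); [exact: ltn_trans|exact: ltnn| |exact: iota_ltn_sorted|exact: perm_mem].
all: apply/(sortedP 0%N) => i h /=; rewrite (uniq_swap_asc ps h); apply: nd; rewrite mem_iota; lia.
Qed.

(** The exchange property: when [s] has a descent at i, one of its reduced words ends in the letter
    i, namely an extension of a reduced word of the swapped list. *)
Lemma reduced_term_down a b s (t : lterm a b) i : reduced_term s t ->
  (i.+1 < size s)%N -> (nth 0%N s i.+1 < nth 0%N s i)%N ->
  exists b' (t' : lterm a b') (g : lnc_gen b' b),
    [/\ lnc_idx g = i, reduced_term (swap_parts s i) t' & reduced_term s (t_comp (t_gen g) t')].
Proof.
move=> rt h ds; have [ps es] := reduced_term_state rt.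
have [|b' [t' rt']] := @ex_reduced_term a (swap_parts s i).
  by apply: perm_trans ps; exact: perm_swap_parts.
have [|||g gi rg] := @reduced_term_step a b' b _ t' i rt'; first by rewrite size_swap_parts.
- by rewrite !nth_swap_parts // /adj_swap !eqxx ifF //; lia.
- by rewrite swap_partsK.
by exists b', t', g; rewrite -{2}(swap_partsK h).
Qed.

Lemma adj_swapL i : adj_swap i i = i.+1.
Proof. by rewrite /adj_swap eqxx. Qed.

Lemma adj_swapR i : adj_swap i i.+1 = i.
Proof. by rewrite /adj_swap eqxx ifF //; lia. Qed.

Lemma adj_swap_id i j : j != i -> j != i.+1 -> adj_swap i j = j.
Proof. by rewrite /adj_swap => /negPf -> /negPf ->. Qed.

Lemma lcong_comp3A a b c d e (k : lterm d e) (h : lterm c d) (g : lterm b c) (f : lterm a b) :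
  lcong (t_comp k (t_comp h (t_comp g f))) (t_comp (t_comp k (t_comp h g)) f).
Proof.
exact: cong_trans (cong_comp (cong_refl _ _) (cong_compA _ _ _ _)) (cong_compA _ _ _ _).
Qed.

(* Matsumoto's theorem for reduced terms, by induction on the length: two     *)
(* reduced words ending in the letters i <> j have a common descendant, from  *)
(* which both ends are reached by the two sides of one defining relation.     *)
Lemma reduced_term_cong a b s (t t' : lterm a b) :
  reduced_term s t -> reduced_term s t' -> lcong t t'.
Proof.
move: {2}(seq_inversions s) (leqnn (seq_inversions s)) => m.
elim: m a b s t t' => [|m IH] a b s t t' le.
  have nd s' (i : nat) : s = swap_parts s' i -> (i.+1 < size s')%N ->
      (nth 0%N s' i < nth 0%N s' i.+1)%N -> False.
    by move=> e h lt; move: le; rewrite e seq_inversions_swap.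
  case/reduced_term_case=> [[_ e]|[b1 [s1 [t1 [g [r1 lt1 e _]]]]]]; last first.
    by case: (nd _ _ e) => //; rewrite (reduced_term_size r1) lnc_idx_lt.
  case/reduced_term_case=> [[_ e']|[b1 [s1 [t1 [g [r1 lt1 e' _]]]]]]; last first.
    by case: (nd _ _ e') => //; rewrite (reduced_term_size r1) lnc_idx_lt.
  have dec (x y : composition n) : {x = y} + {x <> y} by exact: pselect.
  have -> : t = t' by apply: (inj_pair2_eq_dec _ dec); rewrite e e'.
  exact: cong_refl.
(* Comparison of two words with last letters i <= j; the remaining order follows by symmetry of
   congruence. *)
have main b1 b2 (t1 : lterm a b1) (t2 : lterm a b2) (g : lnc_gen b1 b) (g' : lnc_gen b2 b) i j :
    lnc_idx g = i -> lnc_idx g' = j -> perm_eq s (iota 0 (size a)) ->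
    (i.+1 < size s)%N -> (j.+1 < size s)%N ->
    (nth 0%N s i.+1 < nth 0%N s i)%N -> (nth 0%N s j.+1 < nth 0%N s j)%N ->
    reduced_term (swap_parts s i) t1 -> reduced_term (swap_parts s j) t2 -> (i <= j)%N ->
    lcong (t_comp (t_gen g) t1) (t_comp (t_gen g') t2).
  move=> gi gj ps hi hj di dj r1 r2; rewrite leq_eqVlt => /predU1P[eij|].
    move: gj r2; rewrite -eij => gj r2.
    have [_ e1] := reduced_term_state r1; have [_ e2] := reduced_term_state r2.
    have eb : b1 = b2 by apply/val_inj; rewrite /= -e1 -e2.
    case: _ / eb in t2 g' gj r2 e2 *.
    have -> : g' = g by apply: lnc_idx_inj; rewrite gi gj.
    apply: cong_comp; first exact: cong_refl.
    by apply: IH r1 r2; rewrite -ltnS -(seq_inversions_desc hi di).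
  have IHi (t3 t4 : lterm a b1) : reduced_term (swap_parts s i) t3 ->
      reduced_term (swap_parts s i) t4 -> lcong t3 t4.
    by apply: IH; rewrite -ltnS -(seq_inversions_desc hi di).
  have IHj (t3 t4 : lterm a b2) : reduced_term (swap_parts s j) t3 ->
      reduced_term (swap_parts s j) t4 -> lcong t3 t4.
    by apply: IH; rewrite -ltnS -(seq_inversions_desc hj dj).
  rewrite leq_eqVlt => /predU1P[eij|ij].
    (* Adjacent letters: s_i > s_{i+1} > s_{i+2}. Undoing i, i+1, i sorts these three entries and
       leads to [t5]; from there the letters i+1 and i lead up to a word with the list of [t2], and
       the two ways up from [t5] form a braid relation. *)
    move: gj hj dj r2 IHj; rewrite -eij => gj hj dj r2 IHj.
    have [||b3 [t3 [h1 [h1i r3 rh1]]]] := reduced_term_down (i := i.+1) r1.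
    - by rewrite size_swap_parts.
    - by rewrite !nth_swap_parts // adj_swapR adj_swap_id; [apply: ltn_trans di| |]; lia.
    have [||b5 [t5 [h3 [h3i r5 rh3]]]] := reduced_term_down (i := i) r3.
    - by rewrite !size_swap_parts ?size_swap_parts.
    - rewrite !nth_swap_parts ?size_swap_parts // adj_swapL (@adj_swap_id i.+1 i); [|lia|lia].
      by rewrite adj_swapL (@adj_swap_id i i.+2); [|lia|lia].
    have [||b4 [k4 [k4i rk4]]] := reduced_term_up (i := i.+1) r5.
    - by rewrite !size_swap_parts ?size_swap_parts.
    - rewrite !nth_swap_parts ?size_swap_parts //.
      rewrite !(adj_swapL, adj_swapR) (@adj_swap_id i i.+2); [|lia|lia].
      by rewrite !(adj_swapL, adj_swapR) (@adj_swap_id i.+1 i) ?adj_swapL; lia.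
    have eb : swap_parts (swap_parts (swap_parts (swap_parts (swap_parts s i) i.+1) i) i.+1) i
        = swap_parts s i.+1.
      by rewrite (swap_parts_braid hj) !swap_partsK ?size_swap_parts ?size_swap_parts.
    have [|||k2 k2i rk2] := @reduced_term_step _ _ b2 _ _ i rk4.
    - by rewrite !size_swap_parts ?size_swap_parts.
    - rewrite (swap_parts_braid hj) swap_partsK ?size_swap_parts ?size_swap_parts //.
      rewrite !nth_swap_parts ?size_swap_parts // adj_swapL adj_swapR adj_swapL adj_swap_id; [|lia|lia].
      by apply: ltn_trans di.
    - by rewrite eb; have [] := reduced_term_state r2.
    have c1 : lcong t1 (t_comp (t_gen h1) (t_comp (t_gen h3) t5)).
      apply: cong_trans (IHi _ _ r1 rh1) _; apply: cong_comp; first exact: cong_refl.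
      apply: IH r3 rh3; rewrite -ltnS; apply: leq_trans le.
      rewrite (seq_inversions_desc hi di) (@seq_inversions_desc (swap_parts s i) i.+1) //.
      - by rewrite size_swap_parts.
      - by rewrite !nth_swap_parts // adj_swapR adj_swap_id; [apply: ltn_trans di| |]; lia.
    rewrite eb in rk2; have c2 := IHj _ _ r2 rk2.
    apply: cong_trans (cong_comp (cong_refl _ _) c1) _.
    apply: cong_trans (cong_sym (cong_comp (cong_refl _ _) c2)).
    apply: cong_trans (lcong_comp3A _ _ _ _) (cong_trans _ (cong_sym (lcong_comp3A _ _ _ _))).
    apply: cong_comp; last exact: cong_refl.
    by apply: cong_rel; apply: (@lnc_braid _ _ _ _ _ _ _ _ _ _ _ _ _ i).
  (* Distant letters: both descents can be undone independently, and the two ways up from [t3] form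
     a commutation relation. *)
  have [||b3 [t3 [h [hj' r3 rh]]]] := reduced_term_down (i := j) r1.
  - by rewrite size_swap_parts.
  - by rewrite !nth_swap_parts // !adj_swap_id //; lia.
  have e3 : swap_parts (swap_parts (swap_parts s i) j) i = swap_parts s j.
    by rewrite (swap_parts_far hi hj ij) swap_partsK // size_swap_parts.
  have [|||h' hi' rh'] := @reduced_term_step _ _ b2 _ _ i r3.
  - by rewrite !size_swap_parts ?size_swap_parts.
  - rewrite !nth_swap_parts ?size_swap_parts // (@adj_swap_id j i) ?(@adj_swap_id j i.+1); try lia.
    by rewrite adj_swapL adj_swapR.
  - by rewrite e3; have [] := reduced_term_state r2.
  rewrite e3 in rh'.
  apply: cong_trans (cong_comp (cong_refl _ _) (IHi _ _ r1 rh)) _.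
  apply: cong_trans (cong_sym (cong_comp (cong_refl _ _) (IHj _ _ r2 rh'))).
  apply: cong_trans (cong_compA _ _ _ _) _.
  apply: cong_trans (cong_sym (cong_compA _ _ _ _)).
  apply: cong_comp; last exact: cong_refl.
  by apply/cong_rel/(@lnc_far _ _ _ _ _ _ _ _ _ i j); rewrite // ij.
move=> rt rt'; have [ps _] := reduced_term_state rt.
have down b0 s0 (t0 : lterm a b0) (g0 : lnc_gen b0 b) : reduced_term s0 t0 ->
    (nth 0%N s0 (lnc_idx g0) < nth 0%N s0 (lnc_idx g0).+1)%N ->
    s = swap_parts s0 (lnc_idx g0) -> [/\ ((lnc_idx g0).+1 < size s)%N,
    (nth 0%N s (lnc_idx g0).+1 < nth 0%N s (lnc_idx g0))%N &
    s0 = swap_parts s (lnc_idx g0)].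
  move=> r0 lt0 e0; have h0 : ((lnc_idx g0).+1 < size s0)%N.
    by rewrite (reduced_term_size r0) lnc_idx_lt.
  by rewrite e0 size_swap_parts // swap_partsK // !nth_swap_parts // adj_swapL adj_swapR.
have noid b0 s0 (t0 : lterm a b0) (g0 : lnc_gen b0 b) : reduced_term s0 t0 ->
    (nth 0%N s0 (lnc_idx g0) < nth 0%N s0 (lnc_idx g0).+1)%N ->
    s = swap_parts s0 (lnc_idx g0) -> s <> iota 0 (size a).
  move=> r0 lt0 e0 e; have [h0 d0 _] := down _ _ _ _ r0 lt0 e0.
  by move: h0 d0; rewrite e size_iota => h0; rewrite !nth_iota ?(ltnW h0) //; lia.
case/reduced_term_case: (rt) => [[e e1]|[b1 [s1 [t1 [g [r1 lt1 e ->]]]]]];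
  case/reduced_term_case: (rt') => [[e' e1']|[b2 [s2 [t2 [g' [r2 lt2 e' ->]]]]]].
- have dec (x y : composition n) : {x = y} + {x <> y} by exact: pselect.
  have -> : t = t' by apply: (inj_pair2_eq_dec _ dec); rewrite e1 e1'.
  exact: cong_refl.
- by case: (noid _ _ _ _ r2 lt2 e').
- by case: (noid _ _ _ _ r1 lt1 e).
have [h1 d1 es1] := down _ _ _ _ r1 lt1 e; have [h2 d2 es2] := down _ _ _ _ r2 lt2 e'.
rewrite es1 in r1; rewrite es2 in r2.
have [le12|/ltnW le21] := leqP (lnc_idx g) (lnc_idx g').
  exact: (main _ _ _ _ _ _ _ _ erefl erefl).
by apply: cong_sym; exact: (main _ _ _ _ _ _ _ _ erefl erefl).
Qed.

End ReducedTerms.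

(** * The functor psi *)

Section AtomicCosets.
Local Open Scope group_scope.
Variable n : nat.
Implicit Types (a b c : composition n) (s : seq nat).

Lemma simple_inj : injective (@simple n).
Proof.
move=> d e /(congr1 (fun w : 'S_n => w (lo d))).
rewrite /simple tpermL; case: tpermP => [h _|h /(congr1 val) /= e1|_ _ /(congr1 val) /=]; last lia.
  by apply/val_inj; exact: (congr1 val h).
by move/(congr1 val): h => /=; lia.
Qed.

Definition cut_index b c (g : lnc_gen b c) := cast_ord (card_subset_of b) (val g).

Definition merged_subset b c (g : lnc_gen b c) := atomic_source (cut_index g).

Lemma cut_indexE b c (g : lnc_gen b c) :
  (enum_val (cut_index g)).+1 = psum b (lnc_idx g).+1.
Proof. exact: enum_val_cut. Qed.

Lemma ex_target_cut b c (g : lnc_gen b c) : exists d : 'I_n.-1, d.+1 = psum c (lnc_idx g).+1.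
Proof.
have h : (lnc_idx g < (size c).-1)%N.
  by rewrite (lnc_gen_target g) size_swap_parts ?lnc_idx_lt //; have := lnc_idx_lt g; lia.
by exists (enum_val (cast_ord (card_subset_of c) (Ordinal h))); rewrite enum_val_cut.
Qed.

Lemma block_longest b x : block b (longest (subset_of b) x) = block b x.
Proof. by apply: (parabolicP _ (block_function_block b)); exact: longest_parabolic. Qed.

(** w_J is an involution that preserves each block and is decreasing on it, so it exchanges the ends
    of the block. *)
Lemma longest_first_last b j (x y : 'I_n) : (j < size b)%N ->
  x = psum b j :> nat -> y.+1 = psum b j.+1 -> longest (subset_of b) y = x.
Proof.
move=> jb ex ey; have lt := psum_lt (ltnSn j) jb.
have bx : block b x = j by apply: blockE; rewrite // ex leqnn.
have by_ : block b y = j by apply: blockE; rewrite // -ey; lia.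
pose z := longest (subset_of b) x.
have ez : longest (subset_of b) z = x by rewrite /z -permM -{1}longestV mulVg perm1.
have bz : block b z = j by rewrite block_longest.
have [zy|] := ltnP z y; last first.
  have [_] := blockP b z; rewrite bz -ey => /andP[_ h1] h2.
  by rewrite -ez; congr (_ _); apply/val_inj => /=; lia.
have := desc_block (block_function_block b) (@left_desc_longest _ _) zy (etrans bz (esym by_)).
have [_] := blockP b (longest (subset_of b) y).
by rewrite block_longest by_ ez ex; lia.
Qed.

Lemma block_id b (x : 'I_n) :
  block b (longest (subset_of b) x) = nth 0%N (iota 0 (size b)) (block b x).
Proof. by rewrite block_longest nth_iota //; have [] := blockP b x. Qed.

(** This is [star_block_swap] for w_J and the identity list, since w_M absorbs w_J. *)
Lemma longest_merged b c (g : lnc_gen b c) :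
  longest (merged_subset g) =
  block_swap (lnc_idx_lt g) * longest (subset_of b).
Proof.
have [dc edc] := ex_target_cut g.
rewrite -(star_block_swap (lnc_idx_lt g) (lnc_gen_target g) (cut_indexE g) edc
  (@block_id b) (@left_desc_longest _ _)).
  by rewrite star_longestSr // subsetUr.
by rewrite !nth_iota ?(ltnW (lnc_idx_lt g)) ?lnc_idx_lt //; lia.
Qed.

(** Identifies the reflection w_M s w_M in the definition of atomic cosets: w_M sends the two points
    around the cut of [c] to those around the cut of [b], in reverse order. *)
Lemma longest_merged_conj b c (g : lnc_gen b c) (d : 'I_n.-1) : d.+1 = psum c (lnc_idx g).+1 ->
  simple d * longest (merged_subset g) = longest (merged_subset g) * simple (enum_val (cut_index g)).
Proof.
move=> ed; set i := lnc_idx g; set e := enum_val _.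
have ib : (i.+1 < size b)%N := lnc_idx_lt g.
have ee : e.+1 = psum b i.+1 := cut_indexE g.
have ed' : d.+1 = (psum b i + nth 0%N b i.+1)%N.
  by rewrite ed (lnc_gen_target g) psum_swap_parts1 // lnc_idx_lt.
have m1 := part_gt0 (ltnW ib); have m2 := part_gt0 ib.
have e1 : longest (merged_subset g) (lo d) = hi e.
  rewrite longest_merged permM; apply: (@longest_first_last _ i.+1) => //.
  rewrite block_swapE !psumS /swap_points /=; move: m2 m1 ed'; rewrite -/i; do ?case: ifP; lia.
have e2 : longest (merged_subset g) (hi d) = lo e.
  rewrite longest_merged permM.
  have h : longest (subset_of b) (lo e) = block_swap (lnc_idx_lt g) (hi d).
    apply: (@longest_first_last _ i) => //; first exact: ltnW.
    rewrite block_swapE /swap_points /=; move: m2 m1 ed'; rewrite -/i; do ?case: ifP; lia.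
  by rewrite -h -permM -{1}longestV mulVg perm1.
by rewrite conjgC /simple tpermJ e1 e2 tpermC.
Qed.

(** By [longest_merged_conj] the element removed from M is the cut d of [c], and M is [subset_of c]
    with d added. *)
Lemma atomic_targetE b c (g : lnc_gen b c) : atomic_target (cut_index g) = subset_of c.
Proof.
have [d ed] := ex_target_cut g.
have eM : d |: subset_of c = merged_subset g.
  exact (merged_subsetE (lnc_idx_lt g) (lnc_gen_target g) (cut_indexE g) ed).
have dc : d \notin subset_of c.
  apply/subset_ofPn; exists (lnc_idx g) => //.
  by rewrite (lnc_gen_target g) size_swap_parts lnc_idx_lt.
apply/setP => e; rewrite inE -/(merged_subset g) -(longest_merged_conj ed) -eM.
have -> : simple d * longest (d |: subset_of c) * longest (d |: subset_of c) = simple d.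
  by rewrite -mulgA -{1}longestV mulVg mulg1.
rewrite (inj_eq simple_inj) in_setU1; have [->|] := eqVneq e d; first by rewrite (negPf dc).
by rewrite andbT.
Qed.

(** The atomic coset, typed with [subset_of c] instead of the [atomic_target] that is only provably
    equal to it. *)
Definition gen_coset b c (g : lnc_gen b c) : dcoset (subset_of c) (subset_of b) :=
  dcoset_of (subset_of c) (subset_of b) (longest (merged_subset g)).

Lemma gen_coset_arrow b c (g : lnc_gen b c) :
  @arrow (nilCoxeter_algebroid n) _ _ (Dbasis (gen_coset g)) =
  @arrow (nilCoxeter_algebroid n) _ _ (Dbasis (atomic_coset (cut_index g))).
Proof. by rewrite /gen_coset /atomic_coset; case: _ / (atomic_targetE g). Qed.

Lemma gen_coset_atomic b c (g : lnc_gen b c) :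
  generated (@atomic_morphism n) (Dbasis (gen_coset g) : @mor (nilCoxeter_algebroid n) _ _).
Proof.
apply: generated_base; have := AtomicMorphism (cut_index g).
by rewrite /gen_coset /atomic_coset; case: _ / (atomic_targetE g).
Qed.

Lemma dmax_gen_coset b c (g : lnc_gen b c) : dmax (gen_coset g) = longest (merged_subset g).
Proof.
have sb : subset_of b \subset merged_subset g by exact: subsetUr.
have sc : subset_of c \subset merged_subset g.
  by rewrite -(atomic_targetE g); apply/subsetP => d; rewrite inE => /andP[].
by rewrite dmax_of /hull star_longestS // star_longestSr.
Qed.

(** Singles out the cosets that move whole blocks; a general coset, which splits blocks, satisfies
    this for no [s]. *)
Definition block_state a b s (q : dcoset (subset_of b) (subset_of a)) : Prop :=
  forall x, block a (dmax q x) = nth 0%N s (block b x).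

Lemma left_desc_dmax a b (q : dcoset (subset_of b) (subset_of a)) :
  left_desc (subset_of b) (dmax q).
Proof. exact/left_descP/star_longest_dmax. Qed.

(** By [star_block_swap] the star product is the block exchange times [dmax q]; by [longest_merged]
    the block exchange is w_M w_J^-1, so the product is reduced. *)
Lemma gen_coset_asc a b c (g : lnc_gen b c) s (q : dcoset (subset_of b) (subset_of a)) :
  block_state s q -> size s = size b ->
  (nth 0%N s (lnc_idx g) < nth 0%N s (lnc_idx g).+1)%N ->
  Dcomp_basis (gen_coset g) q = Dbasis (dstar (gen_coset g) q) /\
  block_state (swap_parts s (lnc_idx g)) (dstar (gen_coset g) q).
Proof.
move=> sq ss lt; have [d ed] := ex_target_cut g.
have e : star (longest (merged_subset g)) (dmax q) = block_swap (lnc_idx_lt g) * dmax q.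
  exact (star_block_swap (lnc_idx_lt g) (lnc_gen_target g) (cut_indexE g) ed sq (@left_desc_dmax _ _ q) lt).
split=> [|x]; last first.
  rewrite dmax_dstar dmax_gen_coset e permM sq nth_swap_parts ?ss ?lnc_idx_lt //.
  by rewrite (block_block_swap (lnc_idx_lt g) (lnc_gen_target g)).
rewrite /Dcomp_basis ifT // dreducedE dmax_gen_coset e longest_merged.
by rewrite mulgK.
Qed.

(** Here w_M is absorbed by [dmax q], so reducedness would force w_M = w_J. But the cut of [b] is a
    descent of w_M and not of w_J. *)
Lemma gen_coset_desc a b c (g : lnc_gen b c) s (q : dcoset (subset_of b) (subset_of a)) :
  block_state s q -> (nth 0%N s (lnc_idx g).+1 < nth 0%N s (lnc_idx g))%N ->
  Dcomp_basis (gen_coset g) q = 0%R.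
Proof.
move=> sq lt; rewrite /Dcomp_basis ifF //; apply/negbTE/negP.
have /left_descP e : left_desc (merged_subset g) (dmax q).
  exact (left_desc_merged (lnc_idx_lt g) (cut_indexE g) sq (@left_desc_dmax _ _ q) lt).
rewrite dreducedE dmax_gen_coset e => /eqP h.
have em : longest (merged_subset g) = longest (subset_of b).
  apply: (mulIg (longest (subset_of b))^-1); rewrite mulgV.
  by apply: (mulIg (dmax q)); rewrite mul1g.
have dM : enum_val (cut_index g) \in merged_subset g by rewrite in_setU1 eqxx.
have := left_desc_longest dM; rewrite em /desc.
have [e1 e2] := block_cut (lnc_idx_lt g) (cut_indexE g).
apply/negP; rewrite -leqNgt; apply: ltnW; rewrite ltnNge; apply/negP.
by move/(block_function_block b).1; rewrite !block_longest e1 e2 ltnn.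
Qed.

(** As the entries of [s] are distinct, the quotient of the two maximal elements preserves the
    blocks of [b]. *)
Lemma block_state_coset a b s (q q' : dcoset (subset_of b) (subset_of a)) :
  uniq s -> size s = size b -> block_state s q -> block_state s q' -> q = q'.
Proof.
move=> us ss sq sq'.
have uP : dmax q' * (dmax q)^-1 \in parabolic (subset_of b).
  apply/(parabolicP _ (block_function_block b)) => x.
  have := sq ((dmax q' * (dmax q)^-1) x); rewrite permM permKV sq' => /eqP.
  have [h1 _] := blockP b x; have [h2 _] := blockP b ((dmax q)^-1 (dmax q' x)).
  by rewrite nth_uniq ?ss // => /eqP.
rewrite -(dmaxK q) -(dmaxK q'); apply/val_inj => /=; apply/esym/double_coset_eq.
by apply/double_cosetP; exists (dmax q' * (dmax q)^-1), 1; rewrite group1 mulg1 mulgKV.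
Qed.

Lemma block_state_inj a b s s' (q : dcoset (subset_of b) (subset_of a)) :
  size s = size b -> size s' = size b -> block_state s q -> block_state s' q -> s = s'.
Proof.
move=> ss ss' sq sq'; apply: (@eq_from_nth _ 0%N) => [|j]; first by rewrite ss ss'.
rewrite ss => jb; have h : (psum b j < n)%N by have := psum_lt jb (leqnn _); rewrite psum_size.
have <- : block b (Ordinal h) = j by apply: blockE => //=; rewrite leqnn psum_lt.
by rewrite -sq sq'.
Qed.

End AtomicCosets.

(** * The functor and its left inverse on morphisms *)

Section Isomorphism.
Local Open Scope ring_scope.
Variable n : nat.
Implicit Types (a b c : composition n) (s : seq nat).
Notation lterm := (term (@lnc_gen n)).
Notation lrel := (@lnc_rel n).
Notation lcls := (cls lrel).
Notation D := (nilCoxeter_algebroid n).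
Notation AD := (atomic_algebroid n).

Lemma atomic_is_algebroid : is_algebroid AD.
Proof. exact/generated_is_algebroid/nilCoxeter_is_algebroid. Qed.

Lemma gen_coset_gen b c (g : lnc_gen b c) :
  (Dbasis (gen_coset g) : @mor D _ _) \in
    @generated_pred D (@atomic_morphism n) (subset_of b) (subset_of c).
Proof. exact/asboolP/gen_coset_atomic. Qed.

Definition gen_image b c (g : lnc_gen b c) : @mor AD (subset_of b) (subset_of c) :=
  @GeneratedHom D (@atomic_morphism n) _ _ _ (gen_coset_gen g).

Definition lnc_eval a b (t : lterm a b) : @mor AD (subset_of a) (subset_of b) :=
  @term_eval _ _ AD (@subset_of n) gen_image a b t.

Definition lnc_value a b (t : lterm a b) : Dhom (subset_of a) (subset_of b) :=
  gen_val (lnc_eval t).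

Lemma lnc_value_comp a b c (t : lterm b c) (u : lterm a b) :
  lnc_value (t_comp t u) = Dcomp (lnc_value t) (lnc_value u).
Proof. by []. Qed.

Lemma lnc_value_gen b c (g : lnc_gen b c) : lnc_value (t_gen g) = Dbasis (gen_coset g).
Proof. by []. Qed.

(** Reduced terms start from an identity; this lets bare words of generators be compared with
    them. *)
Lemma lnc_value_id1 a b (t : lterm a b) : lnc_value (t_comp t (t_id _ a)) = lnc_value t.
Proof. exact: (compid2 (nilCoxeter_is_algebroid n)). Qed.

Lemma reduced_term_value a b s (t : lterm a b) : reduced_term s t ->
  exists2 q, lnc_value t = Dbasis q & block_state s q.
Proof.
elim=> {b s t} [|b c s t g rt [q eq sq] lt].
  exists (dcoset_of (subset_of a) (subset_of a) 1%g) => // x.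
  by rewrite dmax1 block_id.
have [e s'] := gen_coset_asc sq (reduced_term_size rt) lt.
exists (dstar (gen_coset g) q) => //.
by rewrite lnc_value_comp eq lnc_value_gen Dcomp_basisE.
Qed.

Lemma reduced_term_value_desc a b c s (t : lterm a b) (g : lnc_gen b c) : reduced_term s t ->
  (nth 0%N s (lnc_idx g).+1 < nth 0%N s (lnc_idx g))%N -> lnc_value (t_comp (t_gen g) t) = 0.
Proof.
case/reduced_term_value=> q eq sq lt.
by rewrite lnc_value_comp eq lnc_value_gen Dcomp_basisE (gen_coset_desc sq).
Qed.

Lemma reduced_term_uniq a b s (t : lterm a b) : reduced_term s t -> uniq s.
Proof. by case/reduced_term_state=> ps _; rewrite (perm_uniq ps) iota_uniq. Qed.

Lemma reduced_term_value_eq a b s (t t' : lterm a b) : reduced_term s t -> reduced_term s t' ->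
  lnc_value t = lnc_value t'.
Proof.
move=> rt rt'; have [q -> sq] := reduced_term_value rt; have [q' -> sq'] := reduced_term_value rt'.
by rewrite (block_state_coset (reduced_term_uniq rt) (reduced_term_size rt) sq sq').
Qed.

Lemma reduced_comp_idx a b c s (t : lterm a b) (g : lnc_gen b c) i : lnc_idx g = i ->
  reduced_term s t -> (nth 0%N s i < nth 0%N s i.+1)%N ->
  reduced_term (swap_parts s i) (t_comp (t_gen g) t).
Proof. by move=> <-; exact: reduced_comp. Qed.

(** Started at the identity list, the two sides of a braid or commutation relation are reduced words
    with the same list; in a square of a generator, the second factor meets a descent. *)
Lemma lnc_rel_eval a b (f g : lterm a b) : lrel f g -> lnc_eval f = lnc_eval g.
Proof.
move=> fg; apply/val_inj; rewrite /= -/(lnc_value f) -/(lnc_value g).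
case: fg => {a b f g}.
- move=> a b1 b2 b1' b2' c f1 f2 f3 g1 g2 g3 i [e1 e2 e3] [e1' e2' e3'].
  rewrite !lnc_value_comp -(lnc_value_id1 (t_gen f1)) -(lnc_value_id1 (t_gen g1)) -!lnc_value_comp.
  have h1 : (i.+2 < size a)%N by have := lnc_idx_lt g1; rewrite e1'.
  have [h2 h3] := (ltnW h1, ltnW (ltnW h1)).
  have si : size (iota 0 (size a)) = size a by rewrite size_iota.
  have n0 : nth 0%N (iota 0 (size a)) i = i by rewrite nth_iota.
  have n1 : nth 0%N (iota 0 (size a)) i.+1 = i.+1 by rewrite nth_iota.
  have n2 : nth 0%N (iota 0 (size a)) i.+2 = i.+2 by rewrite nth_iota.
  have r0 := reduced_id a.
  apply: (@reduced_term_value_eq _ _ (swap_parts (swap_parts (swap_parts (iota 0 (size a)) i) i.+1) i)).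
    apply: (reduced_comp_idx e3); first apply: (reduced_comp_idx e2); first apply: (reduced_comp_idx e1) => //.
    + by rewrite n0 n1.
    + by rewrite !nth_swap_parts ?si // adj_swapR adj_swap_id ?n0 ?n2 //; lia.
    + rewrite !nth_swap_parts ?size_swap_parts ?si // adj_swapL (@adj_swap_id i.+1 i); [|lia|lia].
      by rewrite adj_swapL adj_swap_id ?n1 ?n2 //; lia.
  rewrite swap_parts_braid ?si //.
  apply: (reduced_comp_idx e3'); first apply: (reduced_comp_idx e2'); first apply: (reduced_comp_idx e1') => //.
  + by rewrite n1 n2.
  + by rewrite !nth_swap_parts ?si // adj_swapL adj_swap_id ?n0 ?n2 //; lia.
  + rewrite !nth_swap_parts ?size_swap_parts ?si // adj_swapR (@adj_swap_id i i.+2); [|lia|lia].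
    by rewrite adj_swapR adj_swap_id ?n1 ?n0 //; lia.
- move=> a b b' c f1 f2 g1 g2 i j ij f1j f2i g1i g2j.
  rewrite !lnc_value_comp -(lnc_value_id1 (t_gen f1)) -(lnc_value_id1 (t_gen g1)) -!lnc_value_comp.
  have hj : (j.+1 < size a)%N by rewrite -f1j lnc_idx_lt.
  have hi : (i.+1 < size a)%N by rewrite -g1i lnc_idx_lt.
  have si : size (iota 0 (size a)) = size a by rewrite size_iota.
  have ni l : (l < size a)%N -> nth 0%N (iota 0 (size a)) l = l by move=> h; rewrite nth_iota.
  have r0 := reduced_id a.
  have e : swap_parts (swap_parts (iota 0 (size a)) j) i =
      swap_parts (swap_parts (iota 0 (size a)) i) j.
    by case/orP: ij => ij; [apply/esym|]; apply: swap_parts_far; rewrite ?si.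
  apply: (@reduced_term_value_eq _ _ (swap_parts (swap_parts (iota 0 (size a)) j) i)); last rewrite e.
    apply: (reduced_comp_idx f2i); first apply: (reduced_comp_idx f1j) => //.
      by rewrite !ni //; lia.
    by rewrite !nth_swap_parts ?si // !adj_swap_id ?ni //; lia.
  apply: (reduced_comp_idx g2j); first apply: (reduced_comp_idx g1i) => //.
    by rewrite !ni //; lia.
  by rewrite !nth_swap_parts ?si // !adj_swap_id ?ni //; lia.
move=> a b c f1 f2 e; rewrite lnc_value_comp -(lnc_value_id1 (t_gen f1)) -lnc_value_comp.
have h : ((lnc_idx f1).+1 < size a)%N := lnc_idx_lt f1.
have si : size (iota 0 (size a)) = size a by rewrite size_iota.
have lt : (nth 0%N (iota 0 (size a)) (lnc_idx f1) < nth 0%N (iota 0 (size a)) (lnc_idx f1).+1)%N.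
  by rewrite !nth_iota // ltnW.
apply: (reduced_term_value_desc (reduced_comp (reduced_id a) lt)).
by rewrite -e !nth_swap_parts ?si // adj_swapL adj_swapR.
Qed.

Definition psi : functor (LNC n) AD :=
  presented_functor atomic_is_algebroid lnc_rel_eval.

Lemma psi_cls a b (t : lterm a b) : fmap psi (lcls t : @mor (LNC n) a b) = lnc_eval t.
Proof. exact: (presented_mapE atomic_is_algebroid lnc_rel_eval). Qed.

Lemma psi_extends : extends_atomic_assignment psi.
Proof.
split=> [//|a b g]; rewrite /lnc_morphism psi_cls.
exact: gen_coset_arrow.
Qed.

Lemma cls_comp a b c (t : lterm b c) (u : lterm a b) :
  lcls (t_comp t u) = @mcomp (LNC n) _ _ _ (lcls t) (lcls u).
Proof. exact/esym/p_compE. Qed.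

(** Matsumoto's theorem rewrites [t] to end in the letter of [g], and a generator squares to 0. *)
Lemma reduced_term_desc_cls a b c s (t : lterm a b) (g : lnc_gen b c) : reduced_term s t ->
  (nth 0%N s (lnc_idx g).+1 < nth 0%N s (lnc_idx g))%N ->
  lcls (t_comp (t_gen g) t) = lcls (t_zero _ a c).
Proof.
move=> rt ds; have h : ((lnc_idx g).+1 < size s)%N by rewrite (reduced_term_size rt) lnc_idx_lt.
have [b' [t' [g' [gi rt' rgt]]]] := reduced_term_down rt h ds.
have /clsP := reduced_term_cong rt rgt; rewrite !cls_comp => ->.
rewrite (compA (presented_is_algebroid lrel)) -(cls_comp (t_gen g) (t_gen g')).
have -> : lcls (t_comp (t_gen g) (t_gen g')) = lcls (t_zero _ b' c).
  by apply/clsP/cong_rel/lnc_nil.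
exact: (@mcomp0l (LNC n) _ _ _ _ (presented_is_algebroid lrel)).
Qed.

(** The candidate preimage of the basis element of [q], set to 0 when no reduced word has a list
    describing [q]. *)
Definition coset_class a b (q : dcoset (subset_of b) (subset_of a)) : @mor (LNC n) a b :=
  if pselect (exists t : lterm a b, exists2 s, reduced_term s t & block_state s q) is left h
  then lcls (projT1 (cid h)) else 0.

Lemma coset_classP a b (q : dcoset (subset_of b) (subset_of a)) :
  (exists2 t : lterm a b, exists s, reduced_term s t & coset_class q = lcls t) \/
  coset_class q = 0.
Proof.
rewrite /coset_class; case: pselect => [h|_]; last by right.
by left; case: (cid h) => t [s rt sq] /=; exists t; first by exists s.
Qed.

Lemma coset_classE a b s (t : lterm a b) q : reduced_term s t -> block_state s q ->
  coset_class q = lcls t.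
Proof.
move=> rt sq; rewrite /coset_class; case: pselect => [h|[]]; last by exists t, s.
case: (cid h) => t' [s' rt' sq'] /=.
have e := block_state_inj (reduced_term_size rt) (reduced_term_size rt') sq sq'.
by apply/clsP; rewrite -e in rt'; exact: reduced_term_cong rt' rt.
Qed.

Definition retract a b (h : Dhom (subset_of a) (subset_of b)) : @mor (LNC n) a b :=
  \sum_(q : dcoset (subset_of b) (subset_of a)) coset_class q *~ (h : {ffun _ -> _}) q.

Lemma retract_is_zmod a b : zmod_morphism (@retract a b).
Proof.
by move=> f g; rewrite /retract -sumrB; apply: eq_bigr => q _; rewrite !ffunE mulrzBr.
Qed.

Lemma retract_basis a b (q : dcoset (subset_of b) (subset_of a)) :
  retract (Dbasis q) = coset_class q.
Proof.
rewrite /retract (big_only1 q) //; first by rewrite ffunE eqxx.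
by move=> p np _; rewrite ffunE (negPf np).
Qed.

Definition retract_psi a b (f : @mor (LNC n) a b) : @mor (LNC n) a b :=
  retract (gen_val (fmap psi f)).

Lemma retract_psi_is_zmod a b : zmod_morphism (@retract_psi a b).
Proof. by move=> f g; rewrite /retract_psi raddfB -retract_is_zmod. Qed.

HB.instance Definition _ a b := GRing.isZmodMorphism.Build (@mor (LNC n) a b) (@mor (LNC n) a b)
  (@retract_psi a b) (@retract_psi_is_zmod a b).

Lemma retract_psi_reduced a b s (t : lterm a b) : reduced_term s t ->
  retract_psi (lcls t) = lcls t.
Proof.
move=> rt; have [q eq sq] := reduced_term_value rt.
by rewrite /retract_psi psi_cls -/(lnc_value t) eq retract_basis (coset_classE rt).
Qed.

(** A fixed element is a combination of reduced words, and a generator sends each of these to a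
    reduced word or to 0. Induction on [t] extends this to arbitrary left factors. *)
Lemma retract_psi_comp a b c (t : lterm b c) (f : @mor (LNC n) a b) : retract_psi f = f ->
  retract_psi (mcomp (lcls t : @mor (LNC n) b c) f) = mcomp (lcls t : @mor (LNC n) b c) f.
Proof.
have alg := presented_is_algebroid lrel.
elim: t a f => {b c} [b c g|b|b c d t IHt u IHu|b c|b c t IH|b c t IHt u IHu] a f hf.
- pose F : {additive @mor (LNC n) a b -> @mor (LNC n) a c} :=
    HB.pack (fun f => mcomp (lcls (t_gen g) : @mor (LNC n) b c) f)
      (GRing.isZmodMorphism.Build _ _ _ (mcomp_is_zmod (lcls (t_gen g) : @mor (LNC n) b c) alg)).
  pose P : {additive @mor (LNC n) a c -> @mor (LNC n) a c} := @retract_psi a c.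
  (* Being equal to its own retraction, [f] is an integral combination of the classes
     [coset_class q], which are treated one by one. *)
  suff sum_fixed (k : dcoset (subset_of b) (subset_of a) -> int) :
      P (F (\sum_q coset_class q *~ k q)) = F (\sum_q coset_class q *~ k q).
    by rewrite -hf; exact: sum_fixed.
  rewrite !raddf_sum; apply: eq_bigr => q _; rewrite !raddfMz; congr (_ *~ _).
  have [[t [s rt] ->]|->] := coset_classP q; last by rewrite !raddf0.
  have -> : F (lcls t) = lcls (t_comp (t_gen g) t) by exact/esym/cls_comp.
  have [ps _] := reduced_term_state rt.
  have h : ((lnc_idx g).+1 < size s)%N by rewrite (reduced_term_size rt) lnc_idx_lt.
  have := uniq_swap_asc ps h; case: ltnP => [lt _|_ /esym/negbFE ds].
    exact: retract_psi_reduced (reduced_comp rt lt).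
  by rewrite (reduced_term_desc_cls rt ds); exact: raddf0.
- by rewrite (compid1 alg).
- by rewrite cls_comp -(compA alg); apply: IHt; exact: IHu.
- have -> : mcomp (lcls (t_zero _ b c) : @mor (LNC n) b c) f = 0.
    exact: (@mcomp0l (LNC n) _ _ _ f alg).
  exact: raddf0.
- have -> : (lcls (t_opp t) : @mor (LNC n) b c) = - lcls t by exact/esym/p_oppE.
  have -> : mcomp (- lcls t : @mor (LNC n) b c) f = - mcomp (lcls t : @mor (LNC n) b c) f.
    exact: mcompNl.
  by rewrite [LHS]raddfN; congr (- _); exact: IH.
- have -> : (lcls (t_add t u) : @mor (LNC n) b c) = lcls t + lcls u by exact/esym/p_addE.
  by rewrite (compDl alg) [LHS]raddfD; congr (_ + _); [exact: IHt | exact: IHu].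
Qed.

Lemma retract_psiK a b (f : @mor (LNC n) a b) : retract_psi f = f.
Proof.
have alg := presented_is_algebroid lrel.
rewrite -[f](compid2 alg) -(repK f); apply: retract_psi_comp.
exact: retract_psi_reduced (reduced_id a).
Qed.

Lemma psi_faithful a b : injective (@fmap _ _ psi a b).
Proof. by move=> f g e; rewrite -(retract_psiK f) -(retract_psiK g) /retract_psi e. Qed.

(** Fullness by induction on generation. End points are tied to compositions by equations because
    the middle object of a composite is an arbitrary subset, which [subset_of_surj] turns into a
    composition. *)
Lemma psi_generated (x y : D) (f : @mor D x y) : generated (@atomic_morphism n) f ->
  forall a b, subset_of a = x -> subset_of b = y ->
  exists h : @mor (LNC n) a b, @arrow D _ _ (gen_val (fmap psi h)) = arrow f.
Proof.
elim=> {x y f} [x y f|x|x y z g f _ IHg _ IHf|x y|x y f g _ IHf _ IHg] => [[J i]|||| ] a b ea eb.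
- case: _ / ea in i eb *; pose j := cast_ord (esym (card_subset_of a)) i.
  have ec : b == swap j.
    apply/eqP/subset_of_inj; rewrite eb.
    have := @atomic_targetE n a (swap j) (exist _ j (eqxx _)) => <-.
    by congr atomic_target; apply/val_inj.
  exists (lnc_morphism (exist _ j ec : lnc_gen a b)).
  have [_ ->] := psi_extends; rewrite (_ : cast_ord _ _ = i) //; exact/val_inj.
- have e : a = b by apply: subset_of_inj; rewrite ea.
  case: _ / e eb => _; case: _ / ea; exists (idm (a : LNC n)).
  by rewrite (fmap_id psi).
- have [c ec] := subset_of_surj y.
  have [h1 e1] := IHg c b ec eb; have [h2 e2] := IHf a c ea ec.
  exists (mcomp h1 h2); case: _ / ea in f IHf e2 *; case: _ / eb in g IHg e1 *.
  case: _ / ec in f g IHf IHg e1 e2 *.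
  by rewrite (fmap_comp psi) -(arrow_inj e1) -(arrow_inj e2).
- by exists 0; case: _ / ea; case: _ / eb; rewrite raddf0.
have [h1 e1] := IHf a b ea eb; have [h2 e2] := IHg a b ea eb.
exists (h1 - h2); case: _ / ea in f g IHf IHg e1 e2 *; case: _ / eb in f g IHf IHg e1 e2 *.
by rewrite raddfB -(arrow_inj e1) -(arrow_inj e2).
Qed.

Lemma psi_full a b (g : @mor AD (psi a) (psi b)) : exists f, fmap psi f = g.
Proof.
have /asboolP gP := gen_valP g.
have [f e] := psi_generated gP (erefl (subset_of a)) (erefl (subset_of b)).
by exists f; apply/val_inj/arrow_inj.
Qed.

Lemma psi_unique (phi : functor (LNC n) AD) : extends_atomic_assignment phi ->
  forall (a b : LNC n) (f : mor a b), arrow (fmap phi f) = arrow (fmap psi f).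
Proof.
case: phi => fo fm fid fcomp [/= ho hm].
(* Once the object maps are identified, morphisms of both functors have the same type and can be
   compared by induction on a representing term. *)
have e : fo = @subset_of n by apply: funext.
case: _ / (esym e) in fm fid fcomp ho hm *.
move=> a b f; suff -> : fm a b f = fmap psi f by [].
rewrite -(repK f); elim: (rep f) => {a b f}.
- move=> a b g; apply/val_inj/arrow_inj; have [_ e'] := psi_extends.
  by apply: etrans (hm a b g) (esym (e' a b g)).
- by move=> a; rewrite fid (fmap_id psi).
- by move=> a b c t IHt u IHu; rewrite cls_comp fcomp IHt IHu (fmap_comp psi).
- move=> a b; have -> : (lcls (t_zero _ a b) : @mor (LNC n) a b) = 0 by [].
  by rewrite !raddf0.
- move=> a b t IH; have -> : (lcls (t_opp t) : @mor (LNC n) a b) = - lcls t by exact/esym/p_oppE.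
  by rewrite !raddfN IH.
- move=> a b t IHt u IHu.
  have -> : (lcls (t_add t u) : @mor (LNC n) a b) = lcls t + lcls u by exact/esym/p_addE.
  by rewrite !raddfD IHt IHu.
Qed.

End Isomorphism.

Theorem proposition3p19 (n : nat) :
  is_algebroid (LNC n) /\ is_algebroid (atomic_algebroid n) /\
  exists psi : functor (LNC n) (atomic_algebroid n),
    [/\ extends_atomic_assignment psi,
        is_isomorphism psi &
        forall phi : functor (LNC n) (atomic_algebroid n),
          extends_atomic_assignment phi ->
          forall (a b : LNC n) (f : mor a b),
            arrow (fmap phi f) = arrow (fmap psi f)].
Proof.
split; first exact: presented_is_algebroid.
split; first exact: atomic_is_algebroid.
exists (psi n); split; [exact: psi_extends| |exact: psi_unique].
apply: isomorphism_criterion.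
- exact: subset_of_inj.
- exact: subset_of_surj.
- exact: psi_faithful.
- exact: psi_full.
Qed.
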